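(* The equational logic $\mathcal{L}_{\mathrm{eq}}$ is sound. Moreover, for all $\eta,\eta'\in[\![\Gamma]\!]$ with $\eta\sim_\Gamma\eta'$: if $\Gamma\vdash v\equiv_A v'$ is derivable in $\mathcal{L}_{\mathrm{eq}}$ then $[\![\Gamma\vdash v:A]\!]\eta\sim_A[\![\Gamma\vdash v':A]\!]\eta'$; and if $\Gamma\vdash c\equiv_{\underline{C}} c'$ is derivable in $\mathcal{L}_{\mathrm{eq}}$ then $[\![\Gamma\vdash c:\underline{C}]\!]\eta\sim_{\underline{C}}[\![\Gamma\vdash c':\underline{C}]\!]\eta'$.
   Context: We work with a fine-grain call-by-value calculus of algebraic effects and handlers, parametrised by a reasoning logic. Syntax. Values $v ::= x \mid () \mid \mathtt{true} \mid \mathtt{false} \mid \mathtt{fun}\ x \mapsto c \mid \mathtt{handler}\,(\mathtt{return}\ x \mapsto c_r;\ h)$. Computations $c ::= \mathtt{if}\ v\ \mathtt{then}\ c_1\ \mathtt{else}\ c_2 \mid v_1\, v_2 \mid \mathtt{return}\ v \mid \mathit{op}(v; y.c) \mid \mathtt{do}\ x \leftarrow c_1\ \mathtt{in}\ c_2 \mid \mathtt{with}\ v\ \mathtt{handle}\ c$. Operation clauses $h$: finite sets of clauses $\mathit{op}(x;k) \mapsto c_{\mathit{op}}$, at most one per operation. Types: $A,B ::= \mathtt{unit}\mid\mathtt{bool}\mid A\to\underline{C}\mid\underline{C}\Rightarrow\underline{D}$; $\underline{C},\underline{D} ::= A\,!\,\Sigma/\mathcal{E}$; a signature $\Sigma$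 is a finite set of typed operations $\mathit{op}:A_{\mathit{op}}\to B_{\mathit{op}}$ with distinct names; a theory $\mathcal{E}$ is a finite set of equations $(x_i:A_i)_i;(z_j:B_j\to * )_j\vdash T_1\sim T_2$; templates $T ::= z(v)\mid\mathtt{if}\ v\ \mathtt{then}\ T_1\ \mathtt{else}\ T_2\mid\mathit{op}(v;y.T)$. Template typing $\Gamma;Z\vdash T:\Sigma$: $z(v)$ if $(z:A\to * )\in Z$, $\Gamma\vdash v:A$; conditional if $\Gamma\vdash v:\mathtt{bool}$ and branches typed; $\mathit{op}(v;y.T)$ if $(\mathit{op}:A_{\mathit{op}}\to B_{\mathit{op}})\in\Sigma$, $\Gamma\vdash v:A_{\mathit{op}}$, $\Gamma,y:B_{\mathit{op}};Z\vdash T:\Sigma$. $A\,!\,\Sigma/\mathcal{E}$ is well-formed iff its components are and every equation of $\mathcal{E}$ has both templates well-typed over $\Sigma$. Instantiation: $z_j(v)[f_j/z_j]_j=f_j\,v$, $(\mathtt{if}\ v\ \mathtt{then}\ T_1\ \mathtt{else}\ T_2)[f_j/z_j]_j=\mathtt{if}\ v\ \mathtt{then}\ T_1[f_j/z_j]_j\ \mathtt{else}\ T_2[f_j/z_j]_j$, $\mathit{op}(v;y.T)[f_j/z_j]_j=\mathit{op}(v;y.T[f_j/z_j]_j)$. Typing: $\Gamma\vdash x:A$ for $(x:A)\in\Gamma$; $():\mathtt{unit}$; $\mathtt{true},\mathtt{false}:\mathtt{bool}$; $\Gamma\vdash\mathtt{fun}\ x\mapsto c:A\to\underline{C}$ if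 $\Gamma,x:A\vdash c:\underline{C}$; $\Gamma\vdash\mathtt{handler}\,(\mathtt{return}\ x\mapsto c_r;h):A\,!\,\Sigma/\mathcal{E}\Rightarrow\underline{D}$ if $\Gamma,x:A\vdash c_r:\underline{D}$ and $\Gamma\vdash h\models_{\mathcal{E},\Sigma}\underline{D}$; conditionals need $v:\mathtt{bool}$ and both branches of type $\underline{C}$; $v_1\,v_2:\underline{C}$ if $v_1:A\to\underline{C}$, $v_2:A$; $\mathtt{return}\ v:A\,!\,\Sigma/\mathcal{E}$ if $v:A$; $\Gamma\vdash\mathit{op}(v;y.c):A\,!\,\Sigma/\mathcal{E}$ if $(\mathit{op}:A_{\mathit{op}}\to B_{\mathit{op}})\in\Sigma$, $\Gamma\vdash v:A_{\mathit{op}}$, $\Gamma,y:B_{\mathit{op}}\vdash c:A\,!\,\Sigma/\mathcal{E}$; $\Gamma\vdash\mathtt{do}\ x\leftarrow c_1\ \mathtt{in}\ c_2:B\,!\,\Sigma/\mathcal{E}$ if $\Gamma\vdash c_1:A\,!\,\Sigma/\mathcal{E}$, $\Gamma,x:A\vdash c_2:B\,!\,\Sigma/\mathcal{E}$; $\mathtt{with}\ v\ \mathtt{handle}\ c:\underline{D}$ if $v:\underline{C}\Rightarrow\underline{D}$, $c:\underline{C}$. Clauses: $\Gamma\vdash h:\Sigma\Rrightarrow\underline{D}$ iff $h$ has exactly one clause $\mathit{op}(x;k)\mapsto c_{\mathit{op}}$ per $\mathit{op}\in\Sigma$ and no others, with $\Gamma,x:A_{\mathit{op}},k:B_{\mathit{op}}\to\underline{D}\vdash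 c_{\mathit{op}}:\underline{D}$. The logic $\mathcal{L}_{\mathrm{eq}}$: defined mutually with typing, it has equality judgements $\Gamma\vdash v_1\equiv_A v_2$ and $\Gamma\vdash c_1\equiv_{\underline{C}}c_2$ between well-typed terms, generated by reflexivity, symmetry, transitivity, substitution, congruence for every term constructor, the standard $\beta$- and $\eta$-equivalences of the calculus (including $\mathtt{do}\ x\leftarrow\mathtt{return}\ v\ \mathtt{in}\ c\equiv c[v/x]$ and $\mathtt{do}\ x\leftarrow\mathit{op}(v;y.c_1)\ \mathtt{in}\ c_2\equiv\mathit{op}(v;y.\,\mathtt{do}\ x\leftarrow c_1\ \mathtt{in}\ c_2)$), and the rule: if $((x_i:A_i)_i;(z_j:B_j\to * )_j\vdash T_1\sim T_2)\in\mathcal{E}$, $\Gamma\vdash v_i:A_i$ and $\Gamma\vdash f_j:B_j\to A\,!\,\Sigma/\mathcal{E}$, then $\Gamma\vdash (T_1[f_j/z_j]_j)[v_i/x_i]_i\equiv_{A!\Sigma/\mathcal{E}}(T_2[f_j/z_j]_j)[v_i/x_i]_i$. Its well-definedness judgement is given by: $\Gamma\vdash h\models_{\emptyset,\Sigma}\underline{D}$ whenever $\Gamma\vdash h:\Sigma\Rrightarrow\underline{D}$; and $\Gamma\vdash h\models_{\mathcal{E}\cup\{e\},\Sigma}\underline{D}$, for $e=((x_i:A_i)_i;(z_j:B_j\to * )_j\vdash T_1\sim T_2)$, whenever $\Gamma\vdash h\models_{\mathcal{E},\Sigma}\underline{D}$ and $\Gamma,(x_i:A_i)_i,(f_j:B_j\to\underline{D})_j\vdash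 (\!|T_1|\!)_h[f_j/z_j]_j\equiv_{\underline{D}}(\!|T_2|\!)_h[f_j/z_j]_j$, where $(\!|z_j(v)|\!)_h[f_j/z_j]_j=f_j\,v$, $(\!|\mathtt{if}\ v\ \mathtt{then}\ T_1\ \mathtt{else}\ T_2|\!)_h[\ldots]=\mathtt{if}\ v\ \mathtt{then}\ (\!|T_1|\!)_h[\ldots]\ \mathtt{else}\ (\!|T_2|\!)_h[\ldots]$, and $(\!|\mathit{op}(v;y.T)|\!)_h[\ldots]=c_{\mathit{op}}[v/x,(\mathtt{fun}\ y\mapsto(\!|T|\!)_h[\ldots])/k]$ for the clause $\mathit{op}(x;k)\mapsto c_{\mathit{op}}$ of $h$. Denotations (theories ignored): $[\![\mathtt{unit}]\!]=\{\star\}$, $[\![\mathtt{bool}]\!]=\{\mathrm{ff},\mathrm{tt}\}$, function/handler types denote full function sets, $[\![A\,!\,\Sigma/\mathcal{E}]\!]=[\![\Sigma]\!][\![A]\!]$ where $[\![\Sigma]\!]X$ is the inductive set of elements $\mathrm{in}_{\mathrm{return}}(a)$, $a\in X$, and $\mathrm{in}_{\mathit{op}}(a;\kappa)$, $\mathit{op}\in\Sigma$, $a\in[\![A_{\mathit{op}}]\!]$, $\kappa:[\![B_{\mathit{op}}]\!]\to[\![\Sigma]\!]X$. An interpretation $H$ of $\Sigma$ over $Y$: functions $H_{\mathit{op}}:[\![A_{\mathit{op}}]\!]\times([\![B_{\mathit{op}}]\!]\to Y)\to Y$. Free interpretation $(F^X_\Sigma)_{\mathit{op}}(a,\kappa)=\mathrm{in}_{\mathit{op}}(a;\kappa)$.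 Lift: $f^\dagger_H(\mathrm{in}_{\mathrm{return}}(x))=f(x)$, $f^\dagger_H(\mathrm{in}_{\mathit{op}}(x;\kappa))=H_{\mathit{op}}(x,f^\dagger_H\circ\kappa)$. $[\![\varepsilon]\!]=\{\star\}$, $[\![\Gamma,x:A]\!]=[\![\Gamma]\!]\times[\![A]\!]$. For $\eta\in[\![\Gamma]\!]$: variables project; $()\mapsto\star$, $\mathtt{true}\mapsto\mathrm{tt}$, $\mathtt{false}\mapsto\mathrm{ff}$; $[\![\mathtt{fun}\ x\mapsto c]\!]\eta=\lambda a.[\![c]\!](\eta,a)$; $([\![h]\!]\eta)_{\mathit{op}}(a,\kappa)=[\![c_{\mathit{op}}]\!](\eta,a,\kappa)$; $[\![\mathtt{handler}\,(\mathtt{return}\ x\mapsto c_r;h)]\!]\eta=(\lambda a.[\![c_r]\!](\eta,a))^\dagger_{[\![h]\!]\eta}$; conditionals by cases on $[\![v]\!]\eta$; $[\![v_1\,v_2]\!]\eta=([\![v_1]\!]\eta)([\![v_2]\!]\eta)$; $[\![\mathtt{return}\ v]\!]\eta=\mathrm{in}_{\mathrm{return}}([\![v]\!]\eta)$; $[\![\mathit{op}(v;y.c)]\!]\eta=\mathrm{in}_{\mathit{op}}([\![v]\!]\eta;\lambda b.[\![c]\!](\eta,b))$; for $c_2:B\,!\,\Sigma/\mathcal{E}$, $[\![\mathtt{do}\ x\leftarrow c_1\ \mathtt{in}\ c_2]\!]\eta=(\lambda a.[\![c_2]\!](\eta,a))^\dagger_{F^{[\![B]\!]}_\Sigma}([\![c_1]\!]\eta)$;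 $[\![\mathtt{with}\ v\ \mathtt{handle}\ c]\!]\eta=([\![v]\!]\eta)([\![c]\!]\eta)$. Template denotation: for $Z=(z_j:B_j\to * )_j$, $[\![Z]\!]Y=\prod_jY^{[\![B_j]\!]}$; for $H$ over $Y$, $[\![T]\!]_H:[\![\Gamma]\!]\times[\![Z]\!]Y\to Y$ with $[\![z_j(v)]\!]_H(\eta;\zeta)=\zeta_j([\![v]\!]\eta)$, conditionals by cases, $[\![\mathit{op}(v;y.T)]\!]_H(\eta;\zeta)=H_{\mathit{op}}([\![v]\!]\eta,\lambda b.[\![T]\!]_H((\eta,b);\zeta))$. Relations (mutual): $\sim_{\mathtt{unit}},\sim_{\mathtt{bool}}$ are equality; $f\sim_{A\to\underline{C}}f'$ iff $a\sim_Aa'$ implies $f(a)\sim_{\underline{C}}f'(a')$; $h\sim_{\underline{C}\Rightarrow\underline{D}}h'$ iff $t\sim_{\underline{C}}t'$ implies $h(t)\sim_{\underline{D}}h'(t')$; for $\underline{C}=A\,!\,\Sigma/\mathcal{E}$, $\sim_{\underline{C}}$ is the smallest symmetric, transitive relation on $[\![\Sigma]\!][\![A]\!]$ with: $a\sim_Aa'\Rightarrow\mathrm{in}_{\mathrm{return}}(a)\sim_{\underline{C}}\mathrm{in}_{\mathrm{return}}(a')$; for $\mathit{op}\in\Sigma$, $a\sim_{A_{\mathit{op}}}a'$ and $f\sim_{B_{\mathit{op}}\to\underline{C}}f'$ imply $\mathrm{in}_{\mathit{op}}(a;f)\sim_{\underline{C}}\mathrm{in}_{\mathit{op}}(a';f')$;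 for each equation $(x_i:A_i)_i;(z_j:B_j\to * )_j\vdash T_1\sim T_2$ in $\mathcal{E}$, $a_i\sim_{A_i}a_i'$ and $f_j\sim_{B_j\to\underline{C}}f_j'$ imply $[\![T_1]\!]_{F^{[\![A]\!]}_\Sigma}((a_i);(f_j))\sim_{\underline{C}}[\![T_2]\!]_{F^{[\![A]\!]}_\Sigma}((a_i');(f_j'))$. For $\Gamma=(x_i:A_i)_i$, $\eta\sim_\Gamma\eta'$ iff $\eta_i\sim_{A_i}\eta_i'$ for all $i$. Soundness: a logic is sound if whenever $\Gamma\vdash h\models_{\mathcal{E},\Sigma}\underline{D}$ holds in it, then for every equation $(x_i:A_i)_i;(z_j:B_j\to * )_j\vdash T_1\sim T_2$ in $\mathcal{E}$, all $\eta\sim_\Gamma\eta'$, all $a_i\sim_{A_i}a_i'$ and all $f_j\sim_{B_j\to\underline{D}}f_j'$: $[\![T_1]\!]_{[\![h]\!]\eta}((a_i)_i;(f_j)_j)\sim_{\underline{D}}[\![T_2]\!]_{[\![h]\!]\eta'}((a_i')_i;(f_j')_j)$. *)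

(* Defs.v *)
From Stdlib Require Import List Permutation Arith.
Import ListNotations.
Set Implicit Arguments.

(* Raw syntax (de Bruijn indices; index 0 = most recently bound).       *)
(* Types contain theories, theories contain templates, templates       *)
(* contain values, so everything is one mutual block.                  *)
(* Terms carry type annotations (Church style) on binders/cuts so that *)
(* typing derivations are determined by the term.                      *)

Inductive vty : Type :=
| TUnit | TBool
| TFun (A : vty) (C : cty)
| THand (C D : cty)
with cty : Type :=
| CTy (A : vty) (Sg : sig) (E : thy)
with sig : Type :=
| SNil
| SCons (op : nat) (Aop Bop : vty) (Sg : sig)
with thy : Type :=
| ENil
| ECons (e : eqn) (E : thy)
with eqn : Type :=
(* (x_i : A_i)_i ; (z_j : B_j -> * )_j |- T1 ~ T2 ;
   xs is a context (head = de Bruijn index 0), zs is indexed by position j *)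
| Eqn (xs zs : tys) (T1 T2 : tmpl)
with tys : Type :=
| YNil
| YCons (A : vty) (r : tys)
with tmpl : Type :=
| TZ (j : nat) (v : val)
| TIf (v : val) (T1 T2 : tmpl)
| TOp (op : nat) (v : val) (T : tmpl) (* op(v; y.T), binds y *)
with val : Type :=
| VVar (n : nat)
| VUnit | VTrue | VFalse
| VFun (A : vty) (c : comp)
| VHand (C : cty) (cr : comp) (h : hcls)
    (* handler (return x |-> cr; h) with input type annotation C;
       cr binds x; every clause body binds x (index 1) and k (index 0) *)
with comp : Type :=
| CIf (v : val) (c1 c2 : comp)
| CApp (A : vty) (v1 v2 : val)        (* v1 v2, argument type A *)
| CRet (v : val)
| COp (op : nat) (v : val) (c : comp) (* op(v; y.c), binds y *)
| CDo (A : vty) (c1 c2 : comp)        (* do (x:A) <- c1 in c2, binds x *)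
| CWith (C : cty) (v : val) (c : comp)(* with v handle c, c : C *)
with hcls : Type :=
| HNil
| HCons (op : nat) (c : comp) (h : hcls).

Definition up (r : nat -> nat) : nat -> nat :=
  fun n => match n with 0 => 0 | S n => S (r n) end.

Fixpoint renv (r : nat -> nat) (v : val) {struct v} : val :=
  match v with
  | VVar n => VVar (r n)
  | VUnit => VUnit | VTrue => VTrue | VFalse => VFalse
  | VFun A c => VFun A (renc (up r) c)
  | VHand C cr h => VHand C (renc (up r) cr) (renh (up (up r)) h)
  end
with renc (r : nat -> nat) (c : comp) {struct c} : comp :=
  match c with
  | CIf v c1 c2 => CIf (renv r v) (renc r c1) (renc r c2)
  | CApp A v1 v2 => CApp A (renv r v1) (renv r v2)
  | CRet v => CRet (renv r v)
  | COp op v c => COp op (renv r v) (renc (up r) c)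
  | CDo A c1 c2 => CDo A (renc r c1) (renc (up r) c2)
  | CWith C v c => CWith C (renv r v) (renc r c)
  end
with renh (r : nat -> nat) (h : hcls) {struct h} : hcls :=
  match h with
  | HNil => HNil
  | HCons op c h => HCons op (renc r c) (renh r h)
  end.

Definition ups (s : nat -> val) : nat -> val :=
  fun n => match n with 0 => VVar 0 | S n => renv S (s n) end.

Definition scons (v : val) (s : nat -> val) : nat -> val :=
  fun n => match n with 0 => v | S n => s n end.

Fixpoint subv (s : nat -> val) (v : val) {struct v} : val :=
  match v with
  | VVar n => s n
  | VUnit => VUnit | VTrue => VTrue | VFalse => VFalse
  | VFun A c => VFun A (subc (ups s) c)
  | VHand C cr h => VHand C (subc (ups s) cr) (subh (ups (ups s)) h)
  end
with subc (s : nat -> val) (c : comp) {struct c} : comp :=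
  match c with
  | CIf v c1 c2 => CIf (subv s v) (subc s c1) (subc s c2)
  | CApp A v1 v2 => CApp A (subv s v1) (subv s v2)
  | CRet v => CRet (subv s v)
  | COp op v c => COp op (subv s v) (subc (ups s) c)
  | CDo A c1 c2 => CDo A (subc s c1) (subc (ups s) c2)
  | CWith C v c => CWith C (subv s v) (subc s c)
  end
with subh (s : nat -> val) (h : hcls) {struct h} : hcls :=
  match h with
  | HNil => HNil
  | HCons op c h => HCons op (subc s c) (subh s h)
  end.

Definition sub1 (v : val) : nat -> val := scons v VVar.

Fixpoint hl (h : hcls) : list (nat * comp) :=
  match h with HNil => [] | HCons op c h => (op, c) :: hl h end.

Fixpoint hlookup (h : hcls) (op : nat) : comp :=
  match h with
  | HNil => CRet VUnit
  | HCons o c h => if Nat.eqb o op then c else hlookup h op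
  end.

Fixpoint snames (Sg : sig) : list nat :=
  match Sg with SNil => [] | SCons op _ _ Sg => op :: snames Sg end.

Fixpoint slookupB (Sg : sig) (op : nat) : vty :=
  match Sg with
  | SNil => TUnit
  | SCons o _ B Sg => if Nat.eqb o op then B else slookupB Sg op
  end.

Fixpoint tys2l (Z : tys) : list vty :=
  match Z with YNil => [] | YCons A r => A :: tys2l r end.

Definition ztyn (Z : tys) (j : nat) : vty := nth j (tys2l Z) TUnit.

Definition functx (Z : tys) (C : cty) : list vty :=
  map (fun B => TFun B C) (tys2l Z).

Definition exs (e : eqn) : tys := match e with Eqn xs _ _ _ => xs end.
Definition ezs (e : eqn) : tys := match e with Eqn _ zs _ _ => zs end.
Definition eT1 (e : eqn) : tmpl := match e with Eqn _ _ T1 _ => T1 end.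
Definition eT2 (e : eqn) : tmpl := match e with Eqn _ _ _ T2 => T2 end.

(* instantiation (T[f_j/z_j]_j)[v_i/x_i]_i :  s gives the values for the
   template's value variables, fz gives f_j *)
Fixpoint inst (s : nat -> val) (fz : nat -> val) (Z : tys) (T : tmpl) : comp :=
  match T with
  | TZ j v => CApp (ztyn Z j) (fz j) (subv s v)
  | TIf v T1 T2 => CIf (subv s v) (inst s fz Z T1) (inst s fz Z T2)
  | TOp op v T => COp op (subv s v) (inst (ups s) (fun j => renv S (fz j)) Z T)
  end.

(* (|T|)_h [f_j/z_j]_j : s gives values for template value variables,
   fz gives the variables f_j, w gives the values for the variables of
   the context Gamma of the clause bodies *)
Fixpoint htrans (h : hcls) (Sg : sig) (Z : tys)
         (s fz w : nat -> val) (T : tmpl) : comp :=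
  match T with
  | TZ j v => CApp (ztyn Z j) (fz j) (subv s v)
  | TIf v T1 T2 => CIf (subv s v) (htrans h Sg Z s fz w T1)
                                  (htrans h Sg Z s fz w T2)
  | TOp op v T =>
      subc (scons (VFun (slookupB Sg op)
                     (htrans h Sg Z (ups s) (fun j => renv S (fz j))
                             (fun n => renv S (w n)) T))
              (scons (subv s v) w))
           (hlookup h op)
  end.

(* in the context  Gamma, (x_i : A_i)_i, (f_j : B_j -> D)_j , i.e. the
   list  functx zs D ++ tys2l xs ++ Gamma *)
Definition htrans_top (h : hcls) (Sg : sig) (xs zs : tys) (T : tmpl) : comp :=
  htrans h Sg zs (fun n => VVar (length (tys2l zs) + n)) (fun j => VVar j)
         (fun n => VVar (length (tys2l zs) + length (tys2l xs) + n)) T.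

Inductive VarIn : list vty -> nat -> vty -> Type :=
| vin_here G A : VarIn (A :: G) 0 A
| vin_there G n A B : VarIn G n A -> VarIn (B :: G) (S n) A.

Inductive InSig (op : nat) (A B : vty) : sig -> Type :=
| is_here Sg : InSig op A B (SCons op A B Sg)
| is_there o A' B' Sg : InSig op A B Sg -> InSig op A B (SCons o A' B' Sg).

Inductive ZIn : tys -> nat -> vty -> Type :=
| zin_here B r : ZIn (YCons B r) 0 B
| zin_there A r j B : ZIn r j B -> ZIn (YCons A r) (S j) B.

Fixpoint eidx (E : thy) : Type :=
  match E with ENil => Empty_set | ECons _ E => option (eidx E) end.

Fixpoint eqn_at (E : thy) : eidx E -> eqn :=
  match E return eidx E -> eqn with
  | ENil => fun i => match i with end
  | ECons e E' => fun i => match i with None => e | Some i' => eqn_at E' i' end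
  end.

(* Typing, well-formedness of types and the logic L_eq, defined       *)
(* mutually (typing of handlers requires the judgement h |= D).       *)

Inductive vt : list vty -> val -> vty -> Type :=
| vt_var G n A : VarIn G n A -> vt G (VVar n) A
| vt_unit G : vt G VUnit TUnit
| vt_true G : vt G VTrue TBool
| vt_false G : vt G VFalse TBool
| vt_fun G A C c : wfv A -> ct (A :: G) c C -> vt G (VFun A c) (TFun A C)
| vt_hand G A Sg E D cr h :
    wfc (CTy A Sg E) -> ct (A :: G) cr D -> hm G h E Sg D ->
    vt G (VHand (CTy A Sg E) cr h) (THand (CTy A Sg E) D)
with ct : list vty -> comp -> cty -> Type :=
| ct_if G v c1 c2 C : vt G v TBool -> ct G c1 C -> ct G c2 C -> ct G (CIf v c1 c2) C
| ct_app G A C v1 v2 : wfv A -> vt G v1 (TFun A C) -> vt G v2 A -> ct G (CApp A v1 v2) C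
| ct_ret G v A Sg E : vt G v A -> ct G (CRet v) (CTy A Sg E)
| ct_op G op Aop Bop v c A Sg E :
    InSig op Aop Bop Sg -> vt G v Aop -> ct (Bop :: G) c (CTy A Sg E) ->
    ct G (COp op v c) (CTy A Sg E)
| ct_do G A B Sg E c1 c2 :
    wfv A -> ct G c1 (CTy A Sg E) -> ct (A :: G) c2 (CTy B Sg E) ->
    ct G (CDo A c1 c2) (CTy B Sg E)
| ct_with G C D v c : wfc C -> vt G v (THand C D) -> ct G c C -> ct G (CWith C v c) D
with ht : list vty -> hcls -> sig -> cty -> Type :=
| ht_nil G D : ht G HNil SNil D
| ht_cons G op A B Sg D c h :
    ct (TFun B D :: A :: G) c D -> ht G h Sg D -> ht G (HCons op c h) (SCons op A B Sg) D
(* G |- h : Sg => D  (h a finite set of clauses: any order) *)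
with hcl : list vty -> hcls -> sig -> cty -> Type :=
| hcl_perm G h h' Sg D : Permutation (hl h) (hl h') -> ht G h' Sg D -> hcl G h Sg D
with hm : list vty -> hcls -> thy -> sig -> cty -> Type :=
| hm_nil G h Sg D : hcl G h Sg D -> hm G h ENil Sg D
| hm_cons G h xs zs T1 T2 E Sg D :
    hm G h E Sg D ->
    ceq (functx zs D ++ tys2l xs ++ G)
        (htrans_top h Sg xs zs T1) (htrans_top h Sg xs zs T2) D ->
    hm G h (ECons (Eqn xs zs T1 T2) E) Sg D
with hceqa : list vty -> hcls -> hcls -> sig -> cty -> Type :=
| hceqa_nil G D : hceqa G HNil HNil SNil D
| hceqa_cons G op A B Sg D c c' h h' :
    ceq (TFun B D :: A :: G) c c' D -> hceqa G h h' Sg D ->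
    hceqa G (HCons op c h) (HCons op c' h') (SCons op A B Sg) D
with hceq : list vty -> hcls -> hcls -> sig -> cty -> Type :=
| hceq_perm G h h' h1 h1' Sg D :
    Permutation (hl h) (hl h1) -> Permutation (hl h') (hl h1') ->
    hceqa G h1 h1' Sg D -> hceq G h h' Sg D
with vts : list vty -> list val -> list vty -> Type :=
| vts_nil G : vts G [] []
| vts_cons G v vs A As : vt G v A -> vts G vs As -> vts G (v :: vs) (A :: As)
with tpt : list vty -> tys -> tmpl -> sig -> Type :=
| tpt_z G Z j B v Sg : ZIn Z j B -> vt G v B -> tpt G Z (TZ j v) Sg
| tpt_if G Z v T1 T2 Sg : vt G v TBool -> tpt G Z T1 Sg -> tpt G Z T2 Sg -> tpt G Z (TIf v T1 T2) Sg
| tpt_op G Z op A B v T Sg :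
    InSig op A B Sg -> vt G v A -> tpt (B :: G) Z T Sg -> tpt G Z (TOp op v T) Sg
with wfv : vty -> Type :=
| wf_unit : wfv TUnit
| wf_bool : wfv TBool
| wf_fun A C : wfv A -> wfc C -> wfv (TFun A C)
| wf_hand C D : wfc C -> wfc D -> wfv (THand C D)
with wfc : cty -> Type :=
| wf_cty A Sg E : wfv A -> wfs Sg -> wfe E Sg -> wfc (CTy A Sg E)
with wfs : sig -> Type :=
| wf_snil : wfs SNil
| wf_scons op A B Sg : wfv A -> wfv B -> ~ In op (snames Sg) -> wfs Sg -> wfs (SCons op A B Sg)
with wfe : thy -> sig -> Type :=
| wf_enil Sg : wfe ENil Sg
| wf_econs xs zs T1 T2 E Sg :
    wft xs -> wft zs -> tpt (tys2l xs) zs T1 Sg -> tpt (tys2l xs) zs T2 Sg ->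
    wfe E Sg -> wfe (ECons (Eqn xs zs T1 T2) E) Sg
with wft : tys -> Type :=
| wf_ynil : wft YNil
| wf_ycons A r : wfv A -> wft r -> wft (YCons A r)
with veq : list vty -> val -> val -> vty -> Type :=
| veq_refl G v A : vt G v A -> veq G v v A
| veq_sym G v v' A : veq G v v' A -> veq G v' v A
| veq_trans G v1 v2 v3 A : veq G v1 v2 A -> vt G v2 A -> veq G v2 v3 A -> veq G v1 v3 A
| veq_subst G B A v1 v2 w1 w2 :
    wfv B -> vt (B :: G) v1 A -> vt (B :: G) v2 A -> vt G w1 B -> vt G w2 B ->
    veq (B :: G) v1 v2 A -> veq G w1 w2 B ->
    veq G (subv (sub1 w1) v1) (subv (sub1 w2) v2) A
| veq_fun G A C c c' : wfv A -> ceq (A :: G) c c' C -> veq G (VFun A c) (VFun A c') (TFun A C)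
| veq_hand G A Sg E D cr cr' h h' :
    wfc (CTy A Sg E) -> ceq (A :: G) cr cr' D -> hceq G h h' Sg D ->
    veq G (VHand (CTy A Sg E) cr h) (VHand (CTy A Sg E) cr' h') (THand (CTy A Sg E) D)
| veq_eta_unit G v : vt G v TUnit -> veq G v VUnit TUnit
| veq_eta_fun G v A C :
    vt G v (TFun A C) -> veq G (VFun A (CApp A (renv S v) (VVar 0))) v (TFun A C)
with ceq : list vty -> comp -> comp -> cty -> Type :=
| ceq_refl G c C : ct G c C -> ceq G c c C
| ceq_sym G c c' C : ceq G c c' C -> ceq G c' c C
| ceq_trans G c1 c2 c3 C : ceq G c1 c2 C -> ct G c2 C -> ceq G c2 c3 C -> ceq G c1 c3 C
| ceq_subst G B C c1 c2 w1 w2 :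
    wfv B -> ct (B :: G) c1 C -> ct (B :: G) c2 C -> vt G w1 B -> vt G w2 B ->
    ceq (B :: G) c1 c2 C -> veq G w1 w2 B ->
    ceq G (subc (sub1 w1) c1) (subc (sub1 w2) c2) C
| ceq_if G v v' c1 c1' c2 c2' C :
    veq G v v' TBool -> ceq G c1 c1' C -> ceq G c2 c2' C ->
    ceq G (CIf v c1 c2) (CIf v' c1' c2') C
| ceq_app G A C v1 v1' v2 v2' :
    wfv A -> veq G v1 v1' (TFun A C) -> veq G v2 v2' A ->
    ceq G (CApp A v1 v2) (CApp A v1' v2') C
| ceq_ret G v v' A Sg E : veq G v v' A -> ceq G (CRet v) (CRet v') (CTy A Sg E)
| ceq_op G op Aop Bop v v' c c' A Sg E :
    InSig op Aop Bop Sg -> veq G v v' Aop -> ceq (Bop :: G) c c' (CTy A Sg E) ->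
    ceq G (COp op v c) (COp op v' c') (CTy A Sg E)
| ceq_do G A B Sg E c1 c1' c2 c2' :
    wfv A -> ceq G c1 c1' (CTy A Sg E) -> ceq (A :: G) c2 c2' (CTy B Sg E) ->
    ceq G (CDo A c1 c2) (CDo A c1' c2') (CTy B Sg E)
| ceq_with G C D v v' c c' :
    wfc C -> veq G v v' (THand C D) -> ceq G c c' C ->
    ceq G (CWith C v c) (CWith C v' c') D
| ceq_beta_iftrue G c1 c2 C : ct G c1 C -> ct G c2 C -> ceq G (CIf VTrue c1 c2) c1 C
| ceq_beta_iffalse G c1 c2 C : ct G c1 C -> ct G c2 C -> ceq G (CIf VFalse c1 c2) c2 C
| ceq_beta_fun G A C c v :
    wfv A -> ct (A :: G) c C -> vt G v A ->
    ceq G (CApp A (VFun A c) v) (subc (sub1 v) c) C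
| ceq_beta_doret G A B Sg E v c :
    wfv A -> vt G v A -> ct (A :: G) c (CTy B Sg E) ->
    ceq G (CDo A (CRet v) c) (subc (sub1 v) c) (CTy B Sg E)
| ceq_beta_doop G A B Sg E op Aop Bop v c1 c2 :
    wfv A -> InSig op Aop Bop Sg -> vt G v Aop -> ct (Bop :: G) c1 (CTy A Sg E) ->
    ct (A :: G) c2 (CTy B Sg E) ->
    ceq G (CDo A (COp op v c1) c2) (COp op v (CDo A c1 (renc (up S) c2))) (CTy B Sg E)
| ceq_beta_withret G A Sg E D cr h v :
    vt G (VHand (CTy A Sg E) cr h) (THand (CTy A Sg E) D) -> vt G v A ->
    ceq G (CWith (CTy A Sg E) (VHand (CTy A Sg E) cr h) (CRet v)) (subc (sub1 v) cr) D
| ceq_beta_withop G A Sg E D cr h op Aop Bop v c :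
    vt G (VHand (CTy A Sg E) cr h) (THand (CTy A Sg E) D) ->
    InSig op Aop Bop Sg -> vt G v Aop -> ct (Bop :: G) c (CTy A Sg E) ->
    ceq G (CWith (CTy A Sg E) (VHand (CTy A Sg E) cr h) (COp op v c))
          (subc (scons (VFun Bop (CWith (CTy A Sg E) (renv S (VHand (CTy A Sg E) cr h)) c))
                       (scons v VVar))
                (hlookup h op)) D
| ceq_eta_bool G v c C :
    vt G v TBool -> ct (TBool :: G) c C ->
    ceq G (CIf v (subc (sub1 VTrue) c) (subc (sub1 VFalse) c)) (subc (sub1 v) c) C
| ceq_eta_do G c A Sg E :
    ct G c (CTy A Sg E) -> ceq G (CDo A c (CRet (VVar 0))) c (CTy A Sg E)
| ceq_axiom G A Sg E (i : eidx E) vs fs :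
    vts G vs (tys2l (exs (eqn_at E i))) ->
    vts G fs (functx (ezs (eqn_at E i)) (CTy A Sg E)) ->
    ceq G (inst (fun n => nth n vs VUnit) (fun j => nth j fs VUnit)
                (ezs (eqn_at E i)) (eT1 (eqn_at E i)))
          (inst (fun n => nth n vs VUnit) (fun j => nth j fs VUnit)
                (ezs (eqn_at E i)) (eT2 (eqn_at E i)))
          (CTy A Sg E).

(* Denotational semantics (theories ignored)                          *)

Inductive Free (I : Type) (Ar Co : I -> Type) (X : Type) : Type :=
| Ret : X -> Free Ar Co X
| Opn : forall i : I, Ar i -> (Co i -> Free Ar Co X) -> Free Ar Co X.
Arguments Ret {I Ar Co X} _.
Arguments Opn {I Ar Co X} _ _ _.

Fixpoint lift {I : Type} {Ar Co : I -> Type} {X Y : Type}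
         (H : forall i, Ar i -> (Co i -> Y) -> Y) (f : X -> Y)
         (t : Free Ar Co X) : Y :=
  match t with
  | Ret x => f x
  | Opn i a k => H i a (fun b => lift H f (k b))
  end.

Fixpoint sidx (Sg : sig) : Type :=
  match Sg with SNil => Empty_set | SCons _ _ _ Sg => option (sidx Sg) end.

Fixpoint zidx (Z : tys) : Type :=
  match Z with YNil => Empty_set | YCons _ r => option (zidx r) end.

Fixpoint vden (A : vty) : Type :=
  match A with
  | TUnit => unit
  | TBool => bool
  | TFun A C => vden A -> cden C
  | THand C D => cden C -> cden D
  end
with cden (C : cty) : Type :=
  match C with CTy A Sg E => Free (sar Sg) (sco Sg) (vden A) end
with sar (Sg : sig) : sidx Sg -> Type :=
  match Sg return sidx Sg -> Type with
  | SNil => fun i => match i with end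
  | SCons _ A _ Sg' => fun i => match i with None => vden A | Some i' => sar Sg' i' end
  end
with sco (Sg : sig) : sidx Sg -> Type :=
  match Sg return sidx Sg -> Type with
  | SNil => fun i => match i with end
  | SCons _ _ B Sg' => fun i => match i with None => vden B | Some i' => sco Sg' i' end
  end
with zar (Z : tys) : zidx Z -> Type :=
  match Z return zidx Z -> Type with
  | YNil => fun i => match i with end
  | YCons B r => fun i => match i with None => vden B | Some i' => zar r i' end
  end.

Definition FreeS (Sg : sig) (X : Type) : Type := Free (sar Sg) (sco Sg) X.

Definition interp (Sg : sig) (Y : Type) : Type :=
  forall i : sidx Sg, sar Sg i -> (sco Sg i -> Y) -> Y.

Definition freeI (Sg : sig) (X : Type) : interp Sg (FreeS Sg X) :=
  fun i a k => Opn i a k.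

Fixpoint env (G : list vty) : Type :=
  match G with [] => unit | A :: G' => (env G' * vden A)%type end.

Fixpoint proj {G n A} (p : VarIn G n A) : env G -> vden A :=
  match p in VarIn G n A return env G -> vden A with
  | vin_here _ _ => fun e => snd e
  | vin_there _ p' => fun e => proj p' (fst e)
  end.

Fixpoint insig_idx {op A B Sg} (p : InSig op A B Sg) : sidx Sg :=
  match p in InSig _ _ _ Sg return sidx Sg with
  | is_here _ _ _ _ => None
  | is_there _ _ _ p' => Some (insig_idx p')
  end.

Fixpoint insig_ar {op A B Sg} (p : InSig op A B Sg) : vden A -> sar Sg (insig_idx p) :=
  match p in InSig _ _ _ Sg return vden A -> sar Sg (insig_idx p) with
  | is_here _ _ _ _ => fun a => a
  | is_there _ _ _ p' => insig_ar p'
  end.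

Fixpoint insig_co {op A B Sg} (p : InSig op A B Sg) : sco Sg (insig_idx p) -> vden B :=
  match p in InSig _ _ _ Sg return sco Sg (insig_idx p) -> vden B with
  | is_here _ _ _ _ => fun b => b
  | is_there _ _ _ p' => insig_co p'
  end.

Fixpoint zin_idx {Z j B} (p : ZIn Z j B) : zidx Z :=
  match p in ZIn Z _ _ return zidx Z with
  | zin_here _ _ => None
  | zin_there _ p' => Some (zin_idx p')
  end.

Fixpoint zin_in {Z j B} (p : ZIn Z j B) : vden B -> zar Z (zin_idx p) :=
  match p in ZIn Z _ B return vden B -> zar Z (zin_idx p) with
  | zin_here _ _ => fun b => b
  | zin_there _ p' => zin_in p'
  end.

Fixpoint vd {G v A} (d : vt G v A) {struct d} : env G -> vden A :=
  match d in vt G v A return env G -> vden A with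
  | @vt_var _ _ _ p => fun e => proj p e
  | @vt_unit _ => fun _ => tt
  | @vt_true _ => fun _ => true
  | @vt_false _ => fun _ => false
  | @vt_fun _ _ _ _ _ dc => fun e a => cd dc (e, a)
  | @vt_hand _ _ _ _ _ _ _ _ dcr dh => fun e => lift (hmd dh e) (fun a => cd dcr (e, a))
  end
with cd {G c C} (d : ct G c C) {struct d} : env G -> cden C :=
  match d in ct G c C return env G -> cden C with
  | @ct_if _ _ _ _ _ dv d1 d2 => fun e => if vd dv e then cd d1 e else cd d2 e
  | @ct_app _ _ _ _ _ _ d1 d2 => fun e => (vd d1 e) (vd d2 e)
  | @ct_ret _ _ _ _ _ dv => fun e => Ret (vd dv e)
  | @ct_op _ _ _ _ _ _ _ _ _ p dv dc => fun e =>
      Opn (insig_idx p) (insig_ar p (vd dv e)) (fun b => cd dc (e, insig_co p b))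
  | @ct_do _ _ _ _ _ _ _ _ d1 d2 => fun e => lift (@freeI _ _) (fun a => cd d2 (e, a)) (cd d1 e)
  | @ct_with _ _ _ _ _ _ dv dc => fun e => (vd dv e) (cd dc e)
  end
with htd {G h Sg D} (d : ht G h Sg D) {struct d} : env G -> interp Sg (cden D) :=
  match d in ht G h Sg D return env G -> interp Sg (cden D) with
  | @ht_nil _ _ => fun _ i => match i with end
  | @ht_cons _ _ _ _ _ _ _ _ dc dh => fun e i =>
      match i with
      | None => fun a k => cd dc (e, a, k)
      | Some i' => htd dh e i'
      end
  end
with hcld {G h Sg D} (d : hcl G h Sg D) {struct d} : env G -> interp Sg (cden D) :=
  match d with @hcl_perm _ _ _ _ _ _ dh => htd dh end
with hmd {G h E Sg D} (d : hm G h E Sg D) {struct d} : env G -> interp Sg (cden D) :=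
  match d with
  | @hm_nil _ _ _ _ dh => hcld dh
  | @hm_cons _ _ _ _ _ _ _ _ _ dh _ => hmd dh
  end.

Fixpoint tden {G Z T Sg} (d : tpt G Z T Sg) {Y : Type} (H : interp Sg Y)
         {struct d} : env G -> (forall j : zidx Z, zar Z j -> Y) -> Y :=
  match d in tpt G Z T Sg return interp Sg Y -> env G -> (forall j : zidx Z, zar Z j -> Y) -> Y with
  | @tpt_z _ _ _ _ _ _ p dv => fun H e z => z (zin_idx p) (zin_in p (vd dv e))
  | @tpt_if _ _ _ _ _ _ dv d1 d2 => fun H e z => if vd dv e then tden d1 H e z else tden d2 H e z
  | @tpt_op _ _ _ _ _ _ _ _ p dv dT => fun H e z =>
      H (insig_idx p) (insig_ar p (vd dv e)) (fun b => tden dT H (e, insig_co p b) z)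
  end H.

(* ~_{A!Sg/E} : the smallest symmetric, transitive relation on [[Sg]]X
   closed under the return / operation / equation rules.  The relations
   on the component types are parameters (they are supplied by vrel). *)
Inductive CRel (Sg : sig) (E : thy) (X : Type) (RX : X -> X -> Prop)
  (RAr : forall i : sidx Sg, sar Sg i -> sar Sg i -> Prop)
  (RCo : forall i : sidx Sg, sco Sg i -> sco Sg i -> Prop)
  (RxE : forall i : eidx E,
           env (tys2l (exs (eqn_at E i))) -> env (tys2l (exs (eqn_at E i))) -> Prop)
  (RzE : forall (i : eidx E) (j : zidx (ezs (eqn_at E i))),
           zar (ezs (eqn_at E i)) j -> zar (ezs (eqn_at E i)) j -> Prop)
  : FreeS Sg X -> FreeS Sg X -> Prop :=
| CR_ret (a a' : X) : RX a a' -> @CRel Sg E X RX RAr RCo RxE RzE (Ret a) (Ret a')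
| CR_op (i : sidx Sg) (a a' : sar Sg i) (k k' : sco Sg i -> FreeS Sg X) :
    RAr i a a' ->
    (forall b b', RCo i b b' -> @CRel Sg E X RX RAr RCo RxE RzE (k b) (k' b')) ->
    @CRel Sg E X RX RAr RCo RxE RzE (Opn i a k) (Opn i a' k')
| CR_sym t t' : @CRel Sg E X RX RAr RCo RxE RzE t t' -> @CRel Sg E X RX RAr RCo RxE RzE t' t
| CR_trans t1 t2 t3 :
    @CRel Sg E X RX RAr RCo RxE RzE t1 t2 -> @CRel Sg E X RX RAr RCo RxE RzE t2 t3 ->
    @CRel Sg E X RX RAr RCo RxE RzE t1 t3
| CR_eq (i : eidx E)
    (d1 : tpt (tys2l (exs (eqn_at E i))) (ezs (eqn_at E i)) (eT1 (eqn_at E i)) Sg)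
    (d2 : tpt (tys2l (exs (eqn_at E i))) (ezs (eqn_at E i)) (eT2 (eqn_at E i)) Sg)
    (a a' : env (tys2l (exs (eqn_at E i))))
    (f f' : forall j : zidx (ezs (eqn_at E i)), zar (ezs (eqn_at E i)) j -> FreeS Sg X) :
    RxE i a a' ->
    (forall j b b', RzE i j b b' -> @CRel Sg E X RX RAr RCo RxE RzE (f j b) (f' j b')) ->
    @CRel Sg E X RX RAr RCo RxE RzE (tden d1 (@freeI Sg X) a f) (tden d2 (@freeI Sg X) a' f').

Fixpoint vrel (A : vty) : vden A -> vden A -> Prop :=
  match A return vden A -> vden A -> Prop with
  | TUnit => fun x y => x = y
  | TBool => fun x y => x = y
  | TFun A C => fun f g => forall a a', vrel A a a' -> crel C (f a) (g a')
  | THand C D => fun f g => forall t t', crel C t t' -> crel D (f t) (g t')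
  end
with crel (C : cty) : cden C -> cden C -> Prop :=
  match C return cden C -> cden C -> Prop with
  | CTy A Sg E => @CRel Sg E (vden A) (vrel A) (sarrel Sg) (scorel Sg) (exrel E) (ezrel E)
  end
with sarrel (Sg : sig) : forall i : sidx Sg, sar Sg i -> sar Sg i -> Prop :=
  match Sg return forall i : sidx Sg, sar Sg i -> sar Sg i -> Prop with
  | SNil => fun i => match i with end
  | SCons op A B Sg' => fun i =>
      match i return sar (SCons op A B Sg') i -> sar (SCons op A B Sg') i -> Prop with
      | None => vrel A
      | Some i' => sarrel Sg' i'
      end
  end
with scorel (Sg : sig) : forall i : sidx Sg, sco Sg i -> sco Sg i -> Prop :=
  match Sg return forall i : sidx Sg, sco Sg i -> sco Sg i -> Prop with
  | SNil => fun i => match i with end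
  | SCons op A B Sg' => fun i =>
      match i return sco (SCons op A B Sg') i -> sco (SCons op A B Sg') i -> Prop with
      | None => vrel B
      | Some i' => scorel Sg' i'
      end
  end
with tysrel (Z : tys) : env (tys2l Z) -> env (tys2l Z) -> Prop :=
  match Z return env (tys2l Z) -> env (tys2l Z) -> Prop with
  | YNil => fun _ _ => True
  | YCons A r => fun e e' => tysrel r (fst e) (fst e') /\ vrel A (snd e) (snd e')
  end
with zrel (Z : tys) : forall j : zidx Z, zar Z j -> zar Z j -> Prop :=
  match Z return forall j : zidx Z, zar Z j -> zar Z j -> Prop with
  | YNil => fun j => match j with end
  | YCons B r => fun j =>
      match j return zar (YCons B r) j -> zar (YCons B r) j -> Prop with
      | None => vrel B
      | Some j' => zrel r j'
      end
  end
with exrel (E : thy) : forall i : eidx E,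
    env (tys2l (exs (eqn_at E i))) -> env (tys2l (exs (eqn_at E i))) -> Prop :=
  match E return forall i : eidx E,
      env (tys2l (exs (eqn_at E i))) -> env (tys2l (exs (eqn_at E i))) -> Prop with
  | ENil => fun i => match i with end
  | ECons e E' => fun i =>
      match i return env (tys2l (exs (eqn_at (ECons e E') i))) ->
                     env (tys2l (exs (eqn_at (ECons e E') i))) -> Prop with
      | None =>
          match e return env (tys2l (exs e)) -> env (tys2l (exs e)) -> Prop with
          | Eqn xs _ _ _ => tysrel xs
          end
      | Some i' => exrel E' i'
      end
  end
with ezrel (E : thy) : forall (i : eidx E) (j : zidx (ezs (eqn_at E i))),
    zar (ezs (eqn_at E i)) j -> zar (ezs (eqn_at E i)) j -> Prop :=
  match E return forall (i : eidx E) (j : zidx (ezs (eqn_at E i))),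
      zar (ezs (eqn_at E i)) j -> zar (ezs (eqn_at E i)) j -> Prop with
  | ENil => fun i => match i with end
  | ECons e E' => fun i =>
      match i return forall j : zidx (ezs (eqn_at (ECons e E') i)),
                       zar (ezs (eqn_at (ECons e E') i)) j ->
                       zar (ezs (eqn_at (ECons e E') i)) j -> Prop with
      | None =>
          match e return forall j : zidx (ezs e), zar (ezs e) j -> zar (ezs e) j -> Prop with
          | Eqn _ zs _ _ => zrel zs
          end
      | Some i' => ezrel E' i'
      end
  end.

Fixpoint erel (G : list vty) : env G -> env G -> Prop :=
  match G return env G -> env G -> Prop with
  | [] => fun _ _ => True
  | A :: G' => fun e e' => erel G' (fst e) (fst e') /\ vrel A (snd e) (snd e')
  end.

Fixpoint wfctx (G : list vty) : Type :=
  match G with [] => unit | A :: G' => (wfv A * wfctx G')%type end.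

(* Main.v *)
(** Soundness cannot be proved by induction on equational derivations alone: the
    congruence rule for handlers does not carry the derivation that its two
    handlers respect their equations.  We therefore interpret raw terms by a
    denotation relation, defined by recursion on syntax, which additionally
    demands that every handler inside the term validates its theory.  This
    relation is functional, closed under substitution, and forces denotations
    to respect the logical relation.  A single induction over all judgements
    then shows that well-typed terms are in the relation and that derivably
    equal terms in the relation have related denotations.  Functionality also
    gives coherence: the denotation does not depend on the typing derivation. *)

Require Import Defs.
From Stdlib Require Import List.
From Stdlib Require Import Permutation Arith FunctionalExtensionality Eqdep Program.Equality.
Import ListNotations.

(** * Denotations of raw terms *)

(** The Boolean flag of [vsem] answers an obstacle: [CR_eq] and [valid_interp] quantify over all
    typing derivations of the two templates, while an induction reaches only the derivations stored
    in the judgement at hand. At flag [false] every derivation at a well-formed type has its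
    denotation in the relation, by an induction on typing that looks at no equation. Functionality
    holds across flags, so an arbitrary derivation denotes the same as the stored one, for which
    flag [true] is known. The other obstacle is that [~] is only a partial equivalence. Two
    congruent handlers [H] and [H'] each validate the equations, but handling needs the mixed fact:
    [T1] under [H] related to [T2] under [H']. The way is from [T1] to [T2] under [H], then from [H]
    to [H'] with [T2] fixed. The second step requires the values inside [T2] to respect [~], whence
    [good_thy]. *)

Definition valid_interp {G : list vty} {Sg : sig} (E : thy) {D : cty}
  (H : env G -> interp Sg (cden D)) : Prop :=
  forall e e', erel G e e' ->
  forall (i : eidx E)
    (d1 : tpt (tys2l (exs (eqn_at E i))) (ezs (eqn_at E i)) (eT1 (eqn_at E i)) Sg)
    (d2 : tpt (tys2l (exs (eqn_at E i))) (ezs (eqn_at E i)) (eT2 (eqn_at E i)) Sg)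
    (a a' : env (tys2l (exs (eqn_at E i)))),
    erel (tys2l (exs (eqn_at E i))) a a' ->
    forall f f' : forall j : zidx (ezs (eqn_at E i)), zar (ezs (eqn_at E i)) j -> cden D,
      (forall j b b', zrel (ezs (eqn_at E i)) j b b' -> crel D (f j b) (f' j b')) ->
      crel D (tden d1 (H e) a f) (tden d2 (H e') a' f').

Definition clause_pred (G : list vty) (D : cty) : Type :=
  nat -> forall A B : vty, (env (TFun B D :: A :: G) -> cden D) -> Prop.

(** Recursion over positions of the signature lets the types of the components of [H] compute. The
    predicate stays abstract because clauses are found sometimes by first match ([hsem]) and
    sometimes by membership ([clauses_in]). *)
Fixpoint sigsem {G : list vty} {D : cty} (P : clause_pred G D) (Sg : sig) :
  (env G -> interp Sg (cden D)) -> Prop :=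
  match Sg return (env G -> interp Sg (cden D)) -> Prop with
  | SNil => fun _ => True
  | SCons op A B Sg' => fun H =>
      P op A B (fun e => H (fst (fst e)) None (snd (fst e)) (snd e)) /\
      sigsem P Sg' (fun e i => H e (Some i))
  end.

(* [vsem b v G A f]: in context [G], the value [v] has type [A] and denotation
   [f].  Typing here ignores theories; with [b = true] every handler occurring
   in [v] is moreover required to validate its equations semantically. *)
Fixpoint vsem (b : bool) (v : val) (G : list vty) (A : vty) {struct v} :
  (env G -> vden A) -> Prop :=
  match v with
  | VVar n => fun f => exists p : VarIn G n A, f = proj p
  | VUnit =>
      match A return (env G -> vden A) -> Prop with
      | TUnit => fun f => f = (fun _ => tt)
      | _ => fun _ => False
      end
  | VTrue =>
      match A return (env G -> vden A) -> Prop with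
      | TBool => fun f => f = (fun _ => true)
      | _ => fun _ => False
      end
  | VFalse =>
      match A return (env G -> vden A) -> Prop with
      | TBool => fun f => f = (fun _ => false)
      | _ => fun _ => False
      end
  | VFun A0 c =>
      match A return (env G -> vden A) -> Prop with
      | TFun A1 C => fun f =>
          A1 = A0 /\ exists g, csem b c (A1 :: G) C g /\ f = (fun e a => g (e, a))
      | _ => fun _ => False
      end
  | VHand C0 cr h =>
      match A return (env G -> vden A) -> Prop with
      | THand C D => fun f =>
          C = C0 /\
          match C return (env G -> cden C -> cden D) -> Prop with
          | CTy A1 Sg E => fun f =>
              NoDup (snames Sg) /\
              exists g H,
                csem b cr (A1 :: G) D g /\
                sigsem (fun op A B => hsem b h op A B G D) Sg H /\
                (b = true -> valid_interp E H) /\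
                f = (fun e => lift (H e) (fun a => g (e, a)))
          end f
      | _ => fun _ => False
      end
  end
with csem (b : bool) (c : comp) (G : list vty) (C : cty) {struct c} :
  (env G -> cden C) -> Prop :=
  match c with
  | CIf v c1 c2 => fun f =>
      exists g f1 f2, vsem b v G TBool g /\ csem b c1 G C f1 /\ csem b c2 G C f2 /\
        f = (fun e => if g e then f1 e else f2 e)
  | CApp A v1 v2 => fun f =>
      exists g1 g2, vsem b v1 G (TFun A C) g1 /\ vsem b v2 G A g2 /\
        f = (fun e => g1 e (g2 e))
  | CRet v =>
      match C return (env G -> cden C) -> Prop with
      | CTy A Sg E => fun f => exists g, vsem b v G A g /\ f = (fun e => Ret (g e))
      end
  | COp op v c =>
      match C return (env G -> cden C) -> Prop with
      | CTy A Sg E => fun f =>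
          NoDup (snames Sg) /\
          exists Aop Bop (p : InSig op Aop Bop Sg) g k,
            vsem b v G Aop g /\ csem b c (Bop :: G) (CTy A Sg E) k /\
            f = (fun e => Opn (insig_idx p) (insig_ar p (g e))
                              (fun x => k (e, insig_co p x)))
      end
  | CDo A c1 c2 =>
      match C return (env G -> cden C) -> Prop with
      | CTy B Sg E => fun f =>
          exists f1 f2, csem b c1 G (CTy A Sg E) f1 /\ csem b c2 (A :: G) (CTy B Sg E) f2 /\
            f = (fun e => lift (@freeI Sg (vden B)) (fun a => f2 (e, a)) (f1 e))
      end
  | CWith C0 v c => fun f =>
      exists g k, vsem b v G (THand C0 C) g /\ csem b c G C0 k /\ f = (fun e => g e (k e))
  end
with hsem (b : bool) (h : hcls) (op : nat) (A B : vty) (G : list vty) (D : cty) {struct h} :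
  (env (TFun B D :: A :: G) -> cden D) -> Prop :=
  match h with
  | HNil => fun _ => False
  | HCons o c h => fun f =>
      if Nat.eqb o op then csem b c (TFun B D :: A :: G) D f else hsem b h op A B G D f
  end.

(** The interpretation is an argument of the denotation, so that one [F] can be evaluated at the
    free interpretation, at a handler, and at two related interpretations. *)
Fixpoint tsem (b : bool) (T : tmpl) (G : list vty) (Z : tys) (Sg : sig) (Y : Type) {struct T} :
  (interp Sg Y -> env G -> (forall j : zidx Z, zar Z j -> Y) -> Y) -> Prop :=
  match T with
  | TZ j v => fun F =>
      exists B (p : ZIn Z j B) g, vsem b v G B g /\
        F = (fun H e z => z (zin_idx p) (zin_in p (g e)))
  | TIf v T1 T2 => fun F =>
      exists g F1 F2, vsem b v G TBool g /\ tsem b T1 G Z Sg Y F1 /\ tsem b T2 G Z Sg Y F2 /\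
        F = (fun H e z => if g e then F1 H e z else F2 H e z)
  | TOp op v T => fun F =>
      NoDup (snames Sg) /\
      exists A B (p : InSig op A B Sg) g F', vsem b v G A g /\ tsem b T (B :: G) Z Sg Y F' /\
        F = (fun H e z => H (insig_idx p) (insig_ar p (g e))
                            (fun x => F' H (e, insig_co p x) z))
  end.

Scheme val_mind := Induction for val Sort Prop
  with comp_mind := Induction for comp Sort Prop
  with hcls_mind := Induction for hcls Sort Prop.
Combined Scheme term_ind from val_mind, comp_mind, hcls_mind.

(** * Functionality *)

Lemma VarIn_unique {G n A} (p : VarIn G n A) :
  forall B (q : VarIn G n B), existT (VarIn G n) A p = existT _ B q.
Proof.
  induction p as [G A|G n A C p IH]; intros B q; dependent destruction q.
  - reflexivity.
  - specialize (IH _ q). inversion IH; subst.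
    apply inj_pair2 in IH. now subst.
Qed.

Lemma InSig_snames {op A B Sg} : InSig op A B Sg -> In op (snames Sg).
Proof. induction 1; simpl; auto. Qed.

(** This is what the [NoDup] condition at operation nodes of [csem] and [tsem] is for: a repeated
    name would allow two positions, hence two denotations of one term. *)
Lemma InSig_unique {op A B Sg} (p : InSig op A B Sg) :
  NoDup (snames Sg) -> forall A' B' (q : InSig op A' B' Sg),
  existT (fun X => InSig op (fst X) (snd X) Sg) (A, B) p = existT _ (A', B') q.
Proof.
  induction p as [Sg|o A0 B0 Sg p IH]; intros nd A' B' q; inversion_clear nd as [|? ? ni nd'].
  - dependent destruction q; [reflexivity|].
    destruct ni. eapply InSig_snames; eassumption.
  - dependent destruction q.
    + destruct ni. eapply InSig_snames; eassumption.
    + specialize (IH nd' _ _ q). inversion IH; subst.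
      apply inj_pair2 in IH. now subst.
Qed.

Lemma ZIn_unique {Z j A} (p : ZIn Z j A) :
  forall B (q : ZIn Z j B), existT (ZIn Z j) A p = existT _ B q.
Proof.
  induction p as [A r|C r j A p IH]; intros B q; dependent destruction q.
  - reflexivity.
  - specialize (IH _ q). inversion IH; subst.
    apply inj_pair2 in IH. now subst.
Qed.

Ltac unify_VarIn p q :=
  let E := fresh in
  pose proof (VarIn_unique p _ q) as E; inversion E; subst; apply inj_pair2 in E; subst.
Ltac unify_InSig nd p q :=
  let E := fresh in
  pose proof (InSig_unique p nd _ _ q) as E; inversion E; subst; apply inj_pair2 in E; subst.
Ltac unify_ZIn p q :=
  let E := fresh in
  pose proof (ZIn_unique p _ q) as E; inversion E; subst; apply inj_pair2 in E; subst.

Lemma sigsem_mono {G D} (P Q : clause_pred G D) Sg H :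
  (forall op A B f, P op A B f -> Q op A B f) -> sigsem P Sg H -> sigsem Q Sg H.
Proof.
  intros PQ. revert H. induction Sg; simpl; intros H; [trivial|].
  intros [h1 h2]. split; auto.
Qed.

Lemma sigsem_comp {G G' D} (P : clause_pred G D) (Q : clause_pred G' D) (s : env G' -> env G) Sg H :
  (forall op A B f, P op A B f -> Q op A B (fun e => f (s (fst (fst e)), snd (fst e), snd e))) ->
  sigsem P Sg H -> sigsem Q Sg (fun e => H (s e)).
Proof.
  intros PQ. revert H. induction Sg; simpl; intros H; [trivial|].
  intros [h1 h2]. split; [|apply (IHSg _ h2)].
  apply (PQ _ _ _ _ h1).
Qed.

Lemma sigsem_det {G D} (P Q : clause_pred G D) Sg H K :
  (forall op A B f g, P op A B f -> Q op A B g -> f = g) ->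
  sigsem P Sg H -> sigsem Q Sg K -> H = K.
Proof.
  intros PQ hP hQ. apply functional_extensionality; intros e.
  apply functional_extensionality_dep; intros i.
  revert H K hP hQ i. induction Sg; simpl; intros H K hP hQ i; [destruct i|].
  destruct hP as [p1 p2], hQ as [q1 q2]. destruct i as [i|].
  - apply (IHSg _ _ p2 q2).
  - apply functional_extensionality; intros a. apply functional_extensionality; intros k.
    exact (equal_f (PQ _ _ _ _ _ p1 q1) (e, a, k)).
Qed.

Lemma sigsem_InSig {G D} (P : clause_pred G D) Sg op A B (p : InSig op A B Sg) :
  forall H, sigsem P Sg H ->
  P op A B (fun e => H (fst (fst e)) (insig_idx p) (insig_ar p (snd (fst e)))
                       (fun x => snd e (insig_co p x))).
Proof.
  induction p; simpl; intros H [h1 h2]; [exact h1|].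
  apply (IHp _ h2).
Qed.

(** Every existential in the relation is determined by the term, its context and its type. At a
    handler the conjunct depending on the flag constrains [H] without choosing it, so the two flags
    may differ. *)
Lemma sem_det b b' :
  (forall v G A f g, vsem b v G A f -> vsem b' v G A g -> f = g) /\
  (forall c G C f g, csem b c G C f -> csem b' c G C g -> f = g) /\
  (forall h op A B G D f g, hsem b h op A B G D f -> hsem b' h op A B G D g -> f = g).
Proof.
  apply term_ind; simpl.
  - intros n G A f g [p ->] [q ->]. now unify_VarIn p q.
  - intros G A; destruct A; intros f g; try tauto. now intros -> ->.
  - intros G A; destruct A; intros f g; try tauto. now intros -> ->.
  - intros G A; destruct A; intros f g; try tauto. now intros -> ->.
  - intros A0 c IH G A; destruct A; intros f g; try tauto.
    intros [<- [k [h ->]]] [_ [k' [h' ->]]]. now rewrite (IH _ _ _ _ h h').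
  - intros C0 cr IHc h IHh G A; destruct A as [| | |[A Sg E] D]; intros f g; try tauto.
    intros [_ [_ [k [H [h1 [h2 [_ ->]]]]]]] [_ [_ [k' [H' [h1' [h2' [_ ->]]]]]]].
    rewrite (IHc _ _ _ _ h1 h1').
    now rewrite (sigsem_det _ _ _ _ _ (fun op A B f g => IHh op A B G D f g) h2 h2').
  - intros v IHv c1 IH1 c2 IH2 G C f g
      (k & f1 & f2 & a1 & a2 & a3 & ->) (k' & f1' & f2' & b1 & b2 & b3 & ->).
    now rewrite (IHv _ _ _ _ a1 b1), (IH1 _ _ _ _ a2 b2), (IH2 _ _ _ _ a3 b3).
  - intros A v1 IH1 v2 IH2 G C f g (f1 & f2 & a1 & a2 & ->) (f1' & f2' & b1 & b2 & ->).
    now rewrite (IH1 _ _ _ _ a1 b1), (IH2 _ _ _ _ a2 b2).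
  - intros v IHv G [A Sg E] f g (f1 & a1 & ->) (f1' & b1 & ->).
    now rewrite (IHv _ _ _ _ a1 b1).
  - intros op v IHv c IHc G [A Sg E] f g
      (nd & Ao & Bo & p & f1 & k & a1 & a2 & ->) (_ & Ao' & Bo' & p' & f1' & k' & b1 & b2 & ->).
    unify_InSig nd p p'.
    now rewrite (IHv _ _ _ _ a1 b1), (IHc _ _ _ _ a2 b2).
  - intros A c1 IH1 c2 IH2 G [B Sg E] f g (f1 & f2 & a1 & a2 & ->) (f1' & f2' & b1 & b2 & ->).
    now rewrite (IH1 _ _ _ _ a1 b1), (IH2 _ _ _ _ a2 b2).
  - intros C v IHv c IHc G D f g (f1 & f2 & a1 & a2 & ->) (f1' & f2' & b1 & b2 & ->).
    now rewrite (IHv _ _ _ _ a1 b1), (IHc _ _ _ _ a2 b2).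
  - tauto.
  - intros o c IHc h IHh op A B G D f g. destruct (Nat.eqb o op); [apply IHc|apply IHh].
Qed.

Lemma vsem_det {b b' v G A f g} : vsem b v G A f -> vsem b' v G A g -> f = g.
Proof. apply (sem_det b b'). Qed.

Lemma csem_det {b b' c G C f g} : csem b c G C f -> csem b' c G C g -> f = g.
Proof. apply (sem_det b b'). Qed.

Lemma tsem_det {b b' T} : forall {G Z Sg Y F F'},
  tsem b T G Z Sg Y F -> tsem b' T G Z Sg Y F' -> F = F'.
Proof.
  induction T as [j v|v T1 IH1 T2 IH2|op v T IH]; simpl; intros G Z Sg Y F F'.
  - intros (B & p & g & h & ->) (B' & p' & g' & h' & ->).
    unify_ZIn p p'. now rewrite (vsem_det h h').
  - intros (g & F1 & F2 & h & h1 & h2 & ->) (g' & F1' & F2' & h' & h1' & h2' & ->).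
    now rewrite (vsem_det h h'), (IH1 _ _ _ _ _ _ h1 h1'), (IH2 _ _ _ _ _ _ h2 h2').
  - intros (nd & A & B & p & g & k & h & h1 & ->) (_ & A' & B' & p' & g' & k' & h' & h1' & ->).
    unify_InSig nd p p'.
    now rewrite (vsem_det h h'), (IH _ _ _ _ _ _ h1 h1').
Qed.

Lemma sem_forget :
  (forall v G A f, vsem true v G A f -> vsem false v G A f) /\
  (forall c G C f, csem true c G C f -> csem false c G C f) /\
  (forall h op A B G D f, hsem true h op A B G D f -> hsem false h op A B G D f).
Proof.
  apply term_ind; simpl; try (intros; assumption).
  - intros A0 c IH G A; destruct A; intros f; try tauto.
    intros [<- [k [h ->]]]. eauto 6.
  - intros C0 cr IHc h IHh G A; destruct A as [| | |[A Sg E] D]; intros f; try tauto.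
    intros (-> & nd & k & H & h1 & h2 & _ & ->).
    split; [trivial|split; [trivial|exists k, H]]. repeat split; auto; [|discriminate].
    revert h2. apply sigsem_mono. auto.
  - intros v IHv c1 IH1 c2 IH2 G C f (k & f1 & f2 & a1 & a2 & a3 & ->).
    exists k, f1, f2; auto.
  - intros A v1 IH1 v2 IH2 G C f (f1 & f2 & a1 & a2 & ->). exists f1, f2; auto.
  - intros v IHv G [A Sg E] f (f1 & a1 & ->). exists f1; auto.
  - intros op v IHv c IHc G [A Sg E] f (nd & Ao & Bo & p & f1 & k & a1 & a2 & ->).
    split; [trivial|]. exists Ao, Bo, p, f1, k; auto.
  - intros A c1 IH1 c2 IH2 G [B Sg E] f (f1 & f2 & a1 & a2 & ->). exists f1, f2; auto.
  - intros C v IHv c IHc G D f (f1 & f2 & a1 & a2 & ->). exists f1, f2; auto.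
  - intros o c IHc h IHh op A B G D f. destruct (Nat.eqb o op); [apply IHc|apply IHh].
Qed.

(** * Logical relation *)

(** At computation types both laws are constructors of [CRel], so the recursion descends only
    through argument types of functions. Transitivity at a function type uses an argument related to
    itself, which both laws at the argument type provide. *)
Lemma vrel_per A :
  (forall x y, vrel A x y -> vrel A y x) /\
  (forall x y z, vrel A x y -> vrel A y z -> vrel A x z).
Proof.
  assert (cs : forall C x y, crel C x y -> crel C y x)
    by (intros [B Sg E] x y; simpl; apply CR_sym).
  assert (ct : forall C x y z, crel C x y -> crel C y z -> crel C x z)
    by (intros [B Sg E] x y z; simpl; apply CR_trans).
  assert (H : forall A C (sA : forall x y, vrel A x y -> vrel A y x)
    (tA : forall x y z, vrel A x y -> vrel A y z -> vrel A x z),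
    (forall x y, vrel (TFun A C) x y -> vrel (TFun A C) y x) /\
    (forall x y z, vrel (TFun A C) x y -> vrel (TFun A C) y z -> vrel (TFun A C) x z)).
  { intros A1 C sA tA. simpl. split.
    - intros x y h a a' r. apply cs, h. auto.
    - intros x y z h h' a a' r. eapply ct; [apply h|apply h']; eauto. }
  revert A. fix IH 1. intros [| |A C|C D].
  - simpl. split; intros; congruence.
  - simpl. split; intros; congruence.
  - apply H; apply IH.
  - simpl. split.
    + intros x y h a a' r. apply cs, h. auto.
    + intros x y z h h' a a' r. eapply ct; [apply h|apply h']; eauto.
Qed.

Lemma crel_sym C x y : crel C x y -> crel C y x.
Proof. destruct C; simpl; apply CR_sym. Qed.

Lemma crel_trans C x y z : crel C x y -> crel C y z -> crel C x z.
Proof. destruct C; simpl; apply CR_trans. Qed.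

Lemma erel_sym G : forall x y, erel G x y -> erel G y x.
Proof.
  induction G; simpl; [trivial|]. intros x y [h1 h2]. split; [auto|].
  now apply vrel_per.
Qed.

Lemma erel_trans G : forall x y z, erel G x y -> erel G y z -> erel G x z.
Proof.
  induction G; simpl; [trivial|]. intros x y z [h1 h2] [h3 h4]. split; [eauto|].
  eapply vrel_per; eauto.
Qed.

Lemma erel_refl_l G x y : erel G x y -> erel G x x.
Proof. intros h. eapply erel_trans; [exact h|now apply erel_sym]. Qed.

Lemma erel_refl_r G x y : erel G x y -> erel G y y.
Proof. intros h. eapply erel_trans; [apply erel_sym|]; exact h. Qed.

Lemma sarrel_per Sg :
  (forall i x y, sarrel Sg i x y -> sarrel Sg i y x) /\
  (forall i x y z, sarrel Sg i x y -> sarrel Sg i y z -> sarrel Sg i x z).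
Proof.
  induction Sg as [|op A B Sg [IHs IHt]]; (split; intros i; destruct i; simpl);
    solve [apply IHs | apply IHt | apply vrel_per].
Qed.

Lemma scorel_per Sg :
  (forall i x y, scorel Sg i x y -> scorel Sg i y x) /\
  (forall i x y z, scorel Sg i x y -> scorel Sg i y z -> scorel Sg i x z).
Proof.
  induction Sg as [|op A B Sg [IHs IHt]]; (split; intros i; destruct i; simpl);
    solve [apply IHs | apply IHt | apply vrel_per].
Qed.

Lemma zrel_per Z :
  (forall i x y, zrel Z i x y -> zrel Z i y x) /\
  (forall i x y z, zrel Z i x y -> zrel Z i y z -> zrel Z i x z).
Proof.
  induction Z as [|A Z [IHs IHt]]; (split; intros i; destruct i; simpl);
    solve [apply IHs | apply IHt | apply vrel_per].
Qed.

Lemma erel_proj G : forall e e', erel G e e' ->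
  forall n A (p : VarIn G n A), vrel A (proj p e) (proj p e').
Proof.
  intros e e' h n A p. induction p; destruct h as [h1 h2]; simpl; auto.
Qed.

Lemma proj_erel G : forall e e',
  (forall n A (p : VarIn G n A), vrel A (proj p e) (proj p e')) -> erel G e e'.
Proof.
  induction G as [|B G IH]; simpl; [trivial|].
  intros e e' h. split.
  - apply IH. intros n A p. exact (h _ _ (vin_there B p)).
  - exact (h _ _ (vin_here G B)).
Qed.

Lemma tysrel_erel Z : forall e e', tysrel Z e e' <-> erel (tys2l Z) e e'.
Proof. induction Z as [|A Z IH]; simpl; [tauto|]. intros e e'. now rewrite IH. Qed.

Lemma exrel_erel E : forall i e e', exrel E i e e' <-> erel (tys2l (exs (eqn_at E i))) e e'.
Proof.
  induction E as [|[xs zs T1 T2] E IH]; intros i; destruct i; simpl; [apply IH|].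
  apply tysrel_erel.
Qed.

Lemma ezrel_zrel E : forall i j x x', ezrel E i j x x' <-> zrel (ezs (eqn_at E i)) j x x'.
Proof.
  induction E as [|[xs zs T1 T2] E IH]; intros i; destruct i; simpl; [apply IH|].
  reflexivity.
Qed.

Lemma sarrel_insig {op A B Sg} (p : InSig op A B Sg) a a' :
  vrel A a a' -> sarrel Sg (insig_idx p) (insig_ar p a) (insig_ar p a').
Proof. induction p; simpl; auto. Qed.

Lemma scorel_insig {op A B Sg} (p : InSig op A B Sg) : forall x x',
  scorel Sg (insig_idx p) x x' -> vrel B (insig_co p x) (insig_co p x').
Proof. induction p; simpl; auto. Qed.

Lemma zrel_zin {Z j B} (p : ZIn Z j B) x x' :
  vrel B x x' -> zrel Z (zin_idx p) (zin_in p x) (zin_in p x').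
Proof. induction p; simpl; auto. Qed.

Definition interp_rel {Sg D} (H H' : interp Sg (cden D)) : Prop :=
  forall i a a', sarrel Sg i a a' ->
  forall k k', (forall x x', scorel Sg i x x' -> crel D (k x) (k' x')) ->
  crel D (H i a k) (H' i a' k').

(** Lifting is a homomorphism from the free interpretation to [H]. This turns the equation generator
    of [CRel] into the validity condition on [H]. *)
Lemma lift_tden {G Z T Sg} (d : tpt G Z T Sg) X Y (H : interp Sg Y) (f : X -> Y) e z :
  lift H f (tden d (@freeI Sg X) e z) = tden d H e (fun j x => lift H f (z j x)).
Proof.
  revert e z.
  induction d as [| |? ? ? ? ? ? ? ? p dv d IH]; intros e z'; simpl; trivial.
  - destruct (vd _ e); auto.
  - f_equal. apply functional_extensionality; intros x. apply IH.
Qed.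

(* Handling by interpretations that vary over a partial equivalence relation:
   symmetry and transitivity of [~] can only be followed if the two handlers
   may be exchanged, hence the family indexed by [W]. *)
Lemma lift_rel A Sg E D (W : Type) (R : W -> W -> Prop)
  (Rsym : forall w w', R w w' -> R w' w)
  (Rtrans : forall w1 w2 w3, R w1 w2 -> R w2 w3 -> R w1 w3)
  (H : W -> interp Sg (cden D)) (f : W -> vden A -> cden D)
  (Hf : forall w w', R w w' -> forall a a', vrel A a a' -> crel D (f w a) (f w' a'))
  (HH : forall w w', R w w' -> interp_rel (H w) (H w'))
  (HE : forall w w', R w w' -> forall (i : eidx E)
    (d1 : tpt (tys2l (exs (eqn_at E i))) (ezs (eqn_at E i)) (eT1 (eqn_at E i)) Sg)
    (d2 : tpt (tys2l (exs (eqn_at E i))) (ezs (eqn_at E i)) (eT2 (eqn_at E i)) Sg)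
    (a a' : env (tys2l (exs (eqn_at E i)))),
    erel (tys2l (exs (eqn_at E i))) a a' ->
    forall z z' : forall j : zidx (ezs (eqn_at E i)), zar (ezs (eqn_at E i)) j -> cden D,
      (forall j b b', zrel (ezs (eqn_at E i)) j b b' -> crel D (z j b) (z' j b')) ->
      crel D (tden d1 (H w) a z) (tden d2 (H w') a' z')) :
  forall t t', crel (CTy A Sg E) t t' ->
  forall w w', R w w' -> crel D (lift (H w) (f w) t) (lift (H w') (f w') t').
Proof.
  intros t t' h. simpl in h.
  induction h as [a a' ra|i a a' k k' ra rk IH|t t' r IH|t1 t2 t3 r1 IH1 r2 IH2
                 |i d1 d2 a a' z z' ra rz IH]; intros w w' rw; simpl.
  - auto.
  - apply HH; auto.
  - apply crel_sym. auto.
  - eapply crel_trans; [apply IH1|apply IH2]; eauto.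
  - rewrite !lift_tden. apply HE; trivial.
    + now apply exrel_erel.
    + intros j x x' rx. apply IH; trivial. now apply ezrel_zrel.
Qed.

Lemma sigsem_rel {G D} (P Q : clause_pred G D) Sg :
  (forall op A B f g, P op A B f -> Q op A B g ->
     forall e e', erel (TFun B D :: A :: G) e e' -> crel D (f e) (g e')) ->
  forall H K, sigsem P Sg H -> sigsem Q Sg K ->
  forall e e', erel G e e' -> interp_rel (H e) (K e').
Proof.
  intros PQ. induction Sg as [|op A B Sg IH]; intros H K hP hQ e e' re i; [destruct i|].
  destruct hP as [p1 p2], hQ as [q1 q2].
  destruct i as [i|]; simpl.
  - exact (IH _ _ p2 q2 e e' re i).
  - intros a a' ra k k' rk.
    exact (PQ _ _ _ _ _ p1 q1 (e, a, k) (e', a', k') (conj (conj re ra) rk)).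
Qed.

(** Sequencing is handling by the free interpretation. The family for [lift_rel] is constant in the
    interpretation and indexed by the continuations themselves; it validates the equations by
    [CR_eq]. *)
Lemma bind_rel A B Sg E (f f' : vden A -> cden (CTy B Sg E)) t t' :
  (forall a a', vrel A a a' -> crel (CTy B Sg E) (f a) (f' a')) ->
  crel (CTy A Sg E) t t' ->
  crel (CTy B Sg E) (lift (@freeI Sg (vden B)) f t) (lift (@freeI Sg (vden B)) f' t').
Proof.
  intros rf rt.
  refine (@lift_rel A Sg E (CTy B Sg E) (vden A -> cden (CTy B Sg E))
    (vrel (TFun A (CTy B Sg E))) (proj1 (vrel_per (TFun A (CTy B Sg E))))
    (proj2 (vrel_per (TFun A (CTy B Sg E))))
    (fun _ => @freeI Sg (vden B)) (fun f => f) _ _ _ t t' rt f f' rf).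
  - intros w w' h. exact h.
  - intros w w' _ i a a' ra k k' rk. simpl. now apply CR_op.
  - intros w w' _ i d1 d2 a a' ra z z' rz. simpl. apply CR_eq.
    + now apply exrel_erel.
    + intros j x x' rx. apply rz. now apply ezrel_zrel.
Qed.

Lemma sem_rel :
  (forall v G A f, vsem true v G A f ->
     forall e e', erel G e e' -> vrel A (f e) (f e')) /\
  (forall c G C f, csem true c G C f ->
     forall e e', erel G e e' -> crel C (f e) (f e')) /\
  (forall h op A B G D f, hsem true h op A B G D f ->
     forall e e', erel (TFun B D :: A :: G) e e' -> crel D (f e) (f e')).
Proof.
  apply term_ind.
  - intros n G A f [p ->] e e' re. now apply erel_proj.
  - intros G A; destruct A; simpl; intros f; try tauto. now intros ->.
  - intros G A; destruct A; simpl; intros f; try tauto. now intros ->.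
  - intros G A; destruct A; simpl; intros f; try tauto. now intros ->.
  - intros A0 c IH G A; destruct A; simpl; intros f; try tauto.
    intros [<- [k [h ->]]] e e' re a a' ra.
    apply (IH _ _ _ h). split; assumption.
  - intros C0 cr IHc h IHh G A; destruct A as [| | |[A Sg E] D]; simpl; intros f; try tauto.
    intros (_ & _ & g & H & h1 & h2 & hv & ->) e e' re t t' rt.
    (* The family is indexed by environments, and the validity stored at flag [true] is exactly its
       equation hypothesis. *)
    refine (@lift_rel A Sg E D (env G) (erel G) (erel_sym G) (erel_trans G)
      H (fun e a => g (e, a)) _ _ (hv eq_refl) t t' rt e e' re).
    + intros w w' rw a a' ra. apply (IHc _ _ _ h1). split; assumption.
    + intros w w' rw. refine (sigsem_rel _ _ _ _ H H h2 h2 w w' rw).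
      intros op A1 B1 k k' hk hk'.
      (* Functionality merges the two denotations of the clause, since the induction hypothesis
         speaks of a single one. *)
      rewrite <- (proj2 (proj2 (sem_det true true)) _ _ _ _ _ _ _ _ hk hk').
      now apply IHh with (1 := hk).
  - intros v IHv c1 IH1 c2 IH2 G C f (k & f1 & f2 & a1 & a2 & a3 & ->) e e' re.
    pose proof (IHv _ _ _ a1 e e' re) as hb. simpl in hb. rewrite hb.
    destruct (k e'); [apply (IH1 _ _ _ a2)|apply (IH2 _ _ _ a3)]; assumption.
  - intros A v1 IH1 v2 IH2 G C f (f1 & f2 & a1 & a2 & ->) e e' re.
    apply (IH1 _ _ _ a1 e e' re). now apply (IH2 _ _ _ a2).
  - intros v IHv G [A Sg E] f (f1 & a1 & ->) e e' re.
    apply CR_ret. now apply (IHv _ _ _ a1).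
  - intros op v IHv c IHc G [A Sg E] f (nd & Ao & Bo & p & f1 & k & a1 & a2 & ->) e e' re.
    apply CR_op.
    + apply sarrel_insig. now apply (IHv _ _ _ a1).
    + intros x x' rx. apply (IHc _ _ _ a2). split; [assumption|].
      now apply scorel_insig.
  - intros A c1 IH1 c2 IH2 G [B Sg E] f (f1 & f2 & a1 & a2 & ->) e e' re.
    apply bind_rel.
    + intros a a' ra. apply (IH2 _ _ _ a2). split; assumption.
    + now apply (IH1 _ _ _ a1).
  - intros C v IHv c IHc G D f (f1 & f2 & a1 & a2 & ->) e e' re.
    apply (IHv _ _ _ a1 e e' re). now apply (IHc _ _ _ a2).
  - intros op A B G D f [].
  - intros o c IHc h IHh op A B G D f. simpl hsem.
    destruct (Nat.eqb o op); [apply IHc|apply IHh].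
Qed.

Lemma vsem_rel {v G A f} : vsem true v G A f ->
  forall e e', erel G e e' -> vrel A (f e) (f e').
Proof. apply sem_rel. Qed.

Lemma csem_rel {c G C f} : csem true c G C f ->
  forall e e', erel G e e' -> crel C (f e) (f e').
Proof. apply sem_rel. Qed.

(** The template stays fixed and only the interpretation moves, so respect for the operations
    suffices. Handlers inside the values of the template are covered by the flag. *)
Lemma tsem_rel {T} : forall {G Z Sg D F}, tsem true T G Z Sg (cden D) F ->
  forall H H', interp_rel H H' -> forall e e', erel G e e' ->
  forall z z', (forall j x x', zrel Z j x x' -> crel D (z j x) (z' j x')) ->
  crel D (F H e z) (F H' e' z').
Proof.
  induction T as [j v|v T1 IH1 T2 IH2|op v T IH]; intros G Z Sg D F.
  - intros (B & p & g & h & ->) H H' rH e e' re z z' rz.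
    apply rz, zrel_zin. now apply (vsem_rel h).
  - intros (g & F1 & F2 & h & h1 & h2 & ->) H H' rH e e' re z z' rz.
    pose proof (vsem_rel h e e' re) as hb. simpl in hb. rewrite hb.
    destruct (g e'); [apply (IH1 _ _ _ _ _ h1)|apply (IH2 _ _ _ _ _ h2)]; assumption.
  - intros (nd & A & B & p & g & k & h & h1 & ->) H H' rH e e' re z z' rz.
    apply rH.
    + apply sarrel_insig. now apply (vsem_rel h).
    + intros x x' rx. apply (IH _ _ _ _ _ h1); trivial. split; [assumption|].
      now apply scorel_insig.
Qed.

(** * Renaming and substitution *)

(** A syntactic map is paired with a function between environments, and only their agreement on
    variables is required; [sub_sem] follows the same pattern. *)
Definition ren_sem (G G' : list vty) (r : nat -> nat) (s : env G' -> env G) : Prop :=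
  forall n A (p : VarIn G n A), exists q : VarIn G' (r n) A, forall e, proj q e = proj p (s e).

Definition sub_sem (b : bool) (G G' : list vty) (s : nat -> val) (t : env G' -> env G) : Prop :=
  forall n A (p : VarIn G n A), vsem b (s n) G' A (fun e => proj p (t e)).

Definition upe {A G G'} (s : env G' -> env G) (e : env (A :: G')) : env (A :: G) :=
  (s (fst e), snd e).

Lemma ren_sem_rel {G G' r s} : ren_sem G G' r s ->
  forall e e', erel G' e e' -> erel G (s e) (s e').
Proof.
  intros hs e e' re. apply proj_erel. intros n A p.
  destruct (hs n A p) as [q hq]. rewrite <- !hq. now apply erel_proj.
Qed.

Lemma sub_sem_rel {G G' s t} : sub_sem true G G' s t ->
  forall e e', erel G' e e' -> erel G (t e) (t e').
Proof.
  intros hs e e' re. apply proj_erel. intros n A p.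
  exact (vsem_rel (hs n A p) e e' re).
Qed.

Lemma ren_sem_up {A G G' r s} : ren_sem G G' r s -> ren_sem (A :: G) (A :: G') (up r) (upe s).
Proof.
  intros hs n B p. dependent destruction p.
  - exists (vin_here _ _). reflexivity.
  - destruct (hs _ _ p) as [q hq]. exists (vin_there _ q). intros e. apply hq.
Qed.

Lemma valid_interp_comp {G G' Sg E D} (H : env G -> interp Sg (cden D)) (s : env G' -> env G) :
  (forall e e', erel G' e e' -> erel G (s e) (s e')) ->
  valid_interp E H -> valid_interp E (fun e => H (s e)).
Proof. intros hs hv e e' re. apply hv. auto. Qed.

Lemma sem_ren b :
  (forall v G A f, vsem b v G A f -> forall G' r s, ren_sem G G' r s ->
     vsem b (renv r v) G' A (fun e => f (s e))) /\
  (forall c G C f, csem b c G C f -> forall G' r s, ren_sem G G' r s ->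
     csem b (renc r c) G' C (fun e => f (s e))) /\
  (forall h op A B G D f, hsem b h op A B G D f -> forall G' r s, ren_sem G G' r s ->
     hsem b (renh (up (up r)) h) op A B G' D (fun e => f (upe (upe s) e))).
Proof.
  apply term_ind.
  - intros n G A f [p ->] G' r s hs. destruct (hs n A p) as [q hq].
    exists q. apply functional_extensionality. intros e. now rewrite hq.
  - intros G A; destruct A; simpl; intros f; try tauto. now intros ->.
  - intros G A; destruct A; simpl; intros f; try tauto. now intros ->.
  - intros G A; destruct A; simpl; intros f; try tauto. now intros ->.
  - intros A0 c IH G A; destruct A; simpl; intros f; try tauto.
    intros [<- [k [h ->]]] G' r s hs. split; [trivial|].
    eexists. split; [exact (IH _ _ _ h _ _ _ (ren_sem_up hs))|reflexivity].
  - intros C0 cr IHc h IHh G A; destruct A as [| | |[A Sg E] D]; simpl; intros f; try tauto.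
    intros (-> & nd & g & H & h1 & h2 & hv & ->) G' r s hs.
    split; [trivial|split; [trivial|]].
    exists (fun e => g (upe s e)), (fun e => H (s e)). split; [|split; [|split]].
    + exact (IHc _ _ _ h1 _ _ _ (ren_sem_up hs)).
    + revert h2. apply (sigsem_comp (fun op A B => hsem b h op A B G D)
        (fun op A B => hsem b (renh (up (up r)) h) op A B G' D)).
      intros op A1 B1 f hf. exact (IHh _ _ _ _ _ _ hf _ _ _ hs).
    + intros hb. apply valid_interp_comp; [exact (ren_sem_rel hs)|auto].
    + reflexivity.
  - intros v IHv c1 IH1 c2 IH2 G C f (k & f1 & f2 & a1 & a2 & a3 & ->) G' r s hs.
    do 3 eexists. split; [eapply IHv; eauto|split; [eapply IH1; eauto|]].
    split; [eapply IH2; eauto|reflexivity].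
  - intros A v1 IH1 v2 IH2 G C f (f1 & f2 & a1 & a2 & ->) G' r s hs.
    do 2 eexists. split; [eapply IH1; eauto|split; [eapply IH2; eauto|reflexivity]].
  - intros v IHv G [A Sg E] f (f1 & a1 & ->) G' r s hs.
    eexists. split; [eapply IHv; eauto|reflexivity].
  - intros op v IHv c IHc G [A Sg E] f (nd & Ao & Bo & p & f1 & k & a1 & a2 & ->) G' r s hs.
    split; [trivial|]. exists Ao, Bo, p. do 2 eexists.
    split; [eapply IHv; eauto|split; [exact (IHc _ _ _ a2 _ _ _ (ren_sem_up hs))|reflexivity]].
  - intros A c1 IH1 c2 IH2 G [B Sg E] f (f1 & f2 & a1 & a2 & ->) G' r s hs.
    do 2 eexists.
    split; [eapply IH1; eauto|split; [exact (IH2 _ _ _ a2 _ _ _ (ren_sem_up hs))|reflexivity]].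
  - intros C v IHv c IHc G D f (f1 & f2 & a1 & a2 & ->) G' r s hs.
    do 2 eexists. split; [eapply IHv; eauto|split; [eapply IHc; eauto|reflexivity]].
  - intros op A B G D f [].
  - intros o c IHc h IHh op A B G D f. simpl hsem.
    destruct (Nat.eqb o op); intros hf G' r s hs.
    + exact (IHc _ _ _ hf _ _ _ (ren_sem_up (ren_sem_up hs))).
    + exact (IHh _ _ _ _ _ _ hf _ _ _ hs).
Qed.

Lemma ren_sem_S A G : ren_sem G (A :: G) S fst.
Proof. intros n B p. exists (vin_there A p). reflexivity. Qed.

Lemma vsem_weaken {b v G A B f} : vsem b v G A f ->
  vsem b (renv S v) (B :: G) A (fun e => f (fst e)).
Proof. intros h. exact (proj1 (sem_ren b) _ _ _ _ h _ _ _ (ren_sem_S B G)). Qed.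

Lemma sub_sem_weaken {b A G G' s t} : sub_sem b G G' s t ->
  sub_sem b G (A :: G') (fun n => renv S (s n)) (fun e => t (fst e)).
Proof. intros hs n B p. exact (vsem_weaken (hs n B p)). Qed.

Lemma sub_sem_up {b A G G' s t} : sub_sem b G G' s t ->
  sub_sem b (A :: G) (A :: G') (ups s) (upe t).
Proof.
  intros hs n B p. dependent destruction p.
  - exists (vin_here _ _). reflexivity.
  - exact (vsem_weaken (hs _ _ p)).
Qed.

Lemma sub_sem_cons {b A G G' s t v f} : sub_sem b G G' s t -> vsem b v G' A f ->
  sub_sem b (A :: G) G' (scons v s) (fun e => (t e, f e)).
Proof.
  intros hs hv n B p. dependent destruction p; [exact hv|exact (hs _ _ p)].
Qed.

Lemma sub_sem_id b G : sub_sem b G G VVar (fun e => e).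
Proof. intros n A p. exists p. reflexivity. Qed.

Lemma sem_sub b :
  (forall v G A f, vsem b v G A f -> forall G' s t, sub_sem b G G' s t ->
     vsem b (subv s v) G' A (fun e => f (t e))) /\
  (forall c G C f, csem b c G C f -> forall G' s t, sub_sem b G G' s t ->
     csem b (subc s c) G' C (fun e => f (t e))) /\
  (forall h op A B G D f, hsem b h op A B G D f -> forall G' s t, sub_sem b G G' s t ->
     hsem b (subh (ups (ups s)) h) op A B G' D (fun e => f (upe (upe t) e))).
Proof.
  apply term_ind.
  - intros n G A f [p ->] G' s t hs. apply hs.
  - intros G A; destruct A; simpl; intros f; try tauto. now intros ->.
  - intros G A; destruct A; simpl; intros f; try tauto. now intros ->.
  - intros G A; destruct A; simpl; intros f; try tauto. now intros ->.
  - intros A0 c IH G A; destruct A; simpl; intros f; try tauto.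
    intros [<- [k [h ->]]] G' s t hs. split; [trivial|].
    eexists. split; [exact (IH _ _ _ h _ _ _ (sub_sem_up hs))|reflexivity].
  - intros C0 cr IHc h IHh G A; destruct A as [| | |[A Sg E] D]; simpl; intros f; try tauto.
    intros (-> & nd & g & H & h1 & h2 & hv & ->) G' s t hs.
    split; [trivial|split; [trivial|]].
    exists (fun e => g (upe t e)), (fun e => H (t e)). split; [|split; [|split]].
    + exact (IHc _ _ _ h1 _ _ _ (sub_sem_up hs)).
    + revert h2. apply (sigsem_comp (fun op A B => hsem b h op A B G D)
        (fun op A B => hsem b (subh (ups (ups s)) h) op A B G' D)).
      intros op A1 B1 f hf. exact (IHh _ _ _ _ _ _ hf _ _ _ hs).
    (* Validity can be reindexed along maps that preserve [erel]; here the substituted values must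
       themselves carry flag [true]. *)
    + intros ->. apply valid_interp_comp; [exact (sub_sem_rel hs)|auto].
    + reflexivity.
  - intros v IHv c1 IH1 c2 IH2 G C f (k & f1 & f2 & a1 & a2 & a3 & ->) G' s t hs.
    do 3 eexists. split; [eapply IHv; eauto|split; [eapply IH1; eauto|]].
    split; [eapply IH2; eauto|reflexivity].
  - intros A v1 IH1 v2 IH2 G C f (f1 & f2 & a1 & a2 & ->) G' s t hs.
    do 2 eexists. split; [eapply IH1; eauto|split; [eapply IH2; eauto|reflexivity]].
  - intros v IHv G [A Sg E] f (f1 & a1 & ->) G' s t hs.
    eexists. split; [eapply IHv; eauto|reflexivity].
  - intros op v IHv c IHc G [A Sg E] f (nd & Ao & Bo & p & f1 & k & a1 & a2 & ->) G' s t hs.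
    split; [trivial|]. exists Ao, Bo, p. do 2 eexists.
    split; [eapply IHv; eauto|split; [exact (IHc _ _ _ a2 _ _ _ (sub_sem_up hs))|reflexivity]].
  - intros A c1 IH1 c2 IH2 G [B Sg E] f (f1 & f2 & a1 & a2 & ->) G' s t hs.
    do 2 eexists.
    split; [eapply IH1; eauto|split; [exact (IH2 _ _ _ a2 _ _ _ (sub_sem_up hs))|reflexivity]].
  - intros C v IHv c IHc G D f (f1 & f2 & a1 & a2 & ->) G' s t hs.
    do 2 eexists. split; [eapply IHv; eauto|split; [eapply IHc; eauto|reflexivity]].
  - intros op A B G D f [].
  - intros o c IHc h IHh op A B G D f. simpl hsem.
    destruct (Nat.eqb o op); intros hf G' s t hs.
    + exact (IHc _ _ _ hf _ _ _ (sub_sem_up (sub_sem_up hs))).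
    + exact (IHh _ _ _ _ _ _ hf _ _ _ hs).
Qed.

Lemma vsem_sub {b v G A f G' s t} : vsem b v G A f -> sub_sem b G G' s t ->
  vsem b (subv s v) G' A (fun e => f (t e)).
Proof. intros h hs. now apply (sem_sub b). Qed.

Lemma csem_sub {b c G C f G' s t} : csem b c G C f -> sub_sem b G G' s t ->
  csem b (subc s c) G' C (fun e => f (t e)).
Proof. intros h hs. now apply (sem_sub b). Qed.

Lemma sub_sem_sub1 {b A G v f} : vsem b v G A f ->
  sub_sem b (A :: G) G (sub1 v) (fun e => (e, f e)).
Proof. apply (sub_sem_cons (sub_sem_id b G)). Qed.

(** * Coherence of typing *)

Lemma wfs_NoDup {Sg} : wfs Sg -> NoDup (snames Sg).
Proof. induction 1; simpl; constructor; assumption. Qed.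

Lemma wfs_InSig {Sg op A B} : wfs Sg -> InSig op A B Sg -> wfv A * wfv B.
Proof.
  intros w p. induction p; inversion_clear w; auto.
Qed.

Lemma wft_ZIn {Z j B} : wft Z -> ZIn Z j B -> wfv B.
Proof. intros w p. induction p; inversion_clear w; auto. Qed.

Lemma wfc_inv {A Sg E} : wfc (CTy A Sg E) -> wfv A * wfs Sg * wfe E Sg.
Proof. intros w. inversion_clear w. auto. Qed.

Lemma wfe_at {E Sg} : wfe E Sg -> forall i : eidx E,
  wft (exs (eqn_at E i)) * wft (ezs (eqn_at E i)) *
  tpt (tys2l (exs (eqn_at E i))) (ezs (eqn_at E i)) (eT1 (eqn_at E i)) Sg *
  tpt (tys2l (exs (eqn_at E i))) (ezs (eqn_at E i)) (eT2 (eqn_at E i)) Sg.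
Proof.
  intros w. induction w; simpl; intros i; destruct i; simpl; auto.
Qed.

Lemma slookupB_InSig {op A B Sg} : InSig op A B Sg -> NoDup (snames Sg) -> slookupB Sg op = B.
Proof.
  intros p. induction p as [Sg|o A' B' Sg p IH]; simpl; intros nd.
  - now rewrite Nat.eqb_refl.
  - inversion_clear nd as [|? ? ni nd']. destruct (Nat.eqb_spec o op) as [->|_]; [|auto].
    destruct ni. eapply InSig_snames; eassumption.
Qed.

Lemma ztyn_ZIn {Z j B} : ZIn Z j B -> ztyn Z j = B.
Proof. unfold ztyn. induction 1; simpl; auto. Qed.

(** The default body of [hlookup] for a missing clause is never reached, since [hsem] is false on
    the empty list. *)
Lemma hsem_lookup {b op A B G D f} : forall h, hsem b h op A B G D f ->
  csem b (hlookup h op) (TFun B D :: A :: G) D f.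
Proof.
  fix IH 1. intros [|o c h]; [intros []|]. cbn [hsem hlookup].
  destruct (Nat.eqb o op); [trivial|apply IH].
Qed.

Lemma hsem_intro {b op A B G D f c} : forall h, NoDup (map fst (hl h)) -> In (op, c) (hl h) ->
  csem b c (TFun B D :: A :: G) D f -> hsem b h op A B G D f.
Proof.
  fix IH 1. intros [|o c' h]; [intros _ []|]. cbn [hsem hl map fst].
  intros nd hin hc. inversion_clear nd as [|? ? ni nd'].
  destruct hin as [[= -> ->]|hin]; [now rewrite Nat.eqb_refl|].
  destruct (Nat.eqb_spec o op) as [->|_]; [|now apply IH].
  destruct ni. apply in_map_iff. exists (op, c). auto.
Qed.

Lemma hsem_elim {b op A B G D f c} : forall h, NoDup (map fst (hl h)) -> In (op, c) (hl h) ->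
  hsem b h op A B G D f -> csem b c (TFun B D :: A :: G) D f.
Proof.
  fix IH 1. intros [|o c' h]; [intros _ []|]. cbn [hsem hl map fst].
  intros nd hin hc. inversion_clear nd as [|? ? ni nd'].
  destruct hin as [[= -> ->]|hin]; [now rewrite Nat.eqb_refl in hc|].
  destruct (Nat.eqb_spec o op) as [->|_]; [|now apply (IH h)].
  destruct ni. apply in_map_iff. exists (op, c). auto.
Qed.

Lemma ht_names {G h Sg D} : ht G h Sg D -> map fst (hl h) = snames Sg.
Proof.
  revert G h Sg D. fix IH 5. intros G h Sg D [|G1 op A B Sg1 D1 c h1 q d]; simpl; [reflexivity|].
  f_equal. exact (IH _ _ _ _ d).
Qed.

Lemma hceqa_names {G h h' Sg D} : hceqa G h h' Sg D ->
  map fst (hl h) = snames Sg /\ map fst (hl h') = snames Sg.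
Proof.
  revert G h h' Sg D. fix IH 6. intros G h h' Sg D [|G1 op A B Sg1 D1 c c' h1 h1' q d]; simpl; [auto|].
  destruct (IH _ _ _ _ _ d) as [-> ->]. auto.
Qed.

Lemma Permutation_NoDup_fst (l l' : list (nat * comp)) : Permutation l l' ->
  NoDup (map fst l') -> NoDup (map fst l).
Proof.
  intros p. apply Permutation_NoDup. now apply Permutation_map, Permutation_sym.
Qed.

(** Membership is invariant under permuting clauses, whereas [hsem] searches for the first match.
    Typing follows the order of the signature, so denotations are collected here and then moved to
    the order of the given handler. *)
Definition clauses_in (b : bool) (h : hcls) (G : list vty) (D : cty) : clause_pred G D :=
  fun op A B f => exists c, In (op, c) (hl h) /\ csem b c (TFun B D :: A :: G) D f.

Lemma clauses_in_hsem {b h h' G D Sg H} : Permutation (hl h) (hl h') ->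
  NoDup (map fst (hl h')) -> sigsem (clauses_in b h' G D) Sg H ->
  sigsem (fun op A B => hsem b h op A B G D) Sg H.
Proof.
  intros p nd. apply sigsem_mono. intros op A B f (c & hin & hc).
  apply hsem_intro with (3 := hc).
  - now apply Permutation_NoDup_fst with (1 := p).
  - now apply Permutation_in with (1 := Permutation_sym p).
Qed.

Lemma clauses_in_cons {b h G D Sg op A B c f H} :
  csem b c (TFun B D :: A :: G) D f -> sigsem (clauses_in b h G D) Sg H ->
  sigsem (clauses_in b (HCons op c h) G D) (SCons op A B Sg)
    (fun e i => match i with None => fun a k => f (e, a, k) | Some i' => H e i' end).
Proof.
  intros hc hH. split.
  - exists c. split; [now left|].
    (* Pairs have no definitional eta, so an environment rebuilt from its projections is identified
       only up to extensionality. *)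
    refine (eq_ind f (csem b c (TFun B D :: A :: G) D) hc _ _).
    apply functional_extensionality. now intros [[e a] k].
  - change (sigsem (clauses_in b (HCons op c h) G D) Sg H).
    revert hH. apply sigsem_mono.
    intros o A' B' g (c' & hin & hc'). exists c'. split; [now right|exact hc'].
Qed.

Scheme vt_dmind := Induction for vt Sort Prop
  with ct_dmind := Induction for ct Sort Prop
  with ht_dmind := Induction for ht Sort Prop
  with hcl_dmind := Induction for hcl Sort Prop
  with hm_dmind := Induction for hm Sort Prop.
Combined Scheme typing_ind from vt_dmind, ct_dmind, ht_dmind, hcl_dmind, hm_dmind.

(** At flag [false] the equational premise of [hm_cons] is skipped, so induction over the typing
    judgements alone suffices. The result thus covers derivations that the later joint induction
    does not reach. *)
Lemma typing_sem :
  (forall G v A (d : vt G v A), wfv A -> vsem false v G A (vd d)) /\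
  (forall G c C (d : ct G c C), wfc C -> csem false c G C (cd d)) /\
  (forall G h Sg D (d : ht G h Sg D), wfs Sg -> wfc D ->
     sigsem (clauses_in false h G D) Sg (htd d)) /\
  (forall G h Sg D (d : hcl G h Sg D), wfs Sg -> wfc D ->
     sigsem (fun op A B => hsem false h op A B G D) Sg (hcld d)) /\
  (forall G h E Sg D (d : hm G h E Sg D), wfs Sg -> wfc D ->
     sigsem (fun op A B => hsem false h op A B G D) Sg (hmd d)).
Proof.
  apply typing_ind.
  - intros G n A p _. exists p. reflexivity.
  - reflexivity.
  - reflexivity.
  - reflexivity.
  - intros G A C c wA d IH w. inversion_clear w. split; [trivial|].
    exists (cd d). auto.
  - intros G A Sg E D cr h w d IH dh IHh wAD. inversion_clear wAD.
    destruct (wfc_inv w) as [[wA wS] wE].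
    split; [trivial|split; [now apply wfs_NoDup|]].
    exists (cd d), (hmd dh). repeat split; auto. discriminate.
  - intros G v c1 c2 C dv IHv d1 IH1 d2 IH2 w.
    exists (vd dv), (cd d1), (cd d2). repeat split; auto. apply IHv. constructor.
  - intros G A C v1 v2 wA d1 IH1 d2 IH2 w.
    exists (vd d1), (vd d2). split; [|split]; auto. apply IH1. now constructor.
  - intros G v A Sg E dv IHv w. destruct (wfc_inv w) as [[wA wS] wE].
    exists (vd dv). auto.
  - intros G op Ao Bo v c A Sg E p dv IHv d IH w.
    destruct (wfc_inv w) as [[wA wS] wE].
    split; [now apply wfs_NoDup|].
    exists Ao, Bo, p, (vd dv), (cd d). split; [|split]; auto.
    apply IHv. now destruct (wfs_InSig wS p).
  - intros G A B Sg E c1 c2 wA d1 IH1 d2 IH2 w.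
    destruct (wfc_inv w) as [[wB wS] wE].
    exists (cd d1), (cd d2). split; [|split]; auto. apply IH1. now constructor.
  - intros G C D v c wC dv IHv d IH w.
    exists (vd dv), (cd d). split; [|split]; auto. apply IHv. now constructor.
  - intros G D _ _. exact I.
  - intros G op A B Sg D c h d IH dh IHh wS wD. inversion_clear wS.
    apply clauses_in_cons; auto.
  - intros G h h' Sg D pm dh IHh wS wD.
    apply (clauses_in_hsem pm); [|auto].
    rewrite (ht_names dh). now apply wfs_NoDup.
  - intros G h Sg D dh IHh wS wD. apply IHh; assumption.
  - intros G h xs zs T1 T2 E Sg D dh IHh q wS wD. apply IHh; assumption.
Qed.

Lemma tpt_tsem {G Z T Sg} (d : tpt G Z T Sg) Y : wft Z -> wfs Sg ->
  tsem false T G Z Sg Y (fun H => tden d H).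
Proof.
  intros wZ wS.
  induction d as [G Z j B v Sg p dv|G Z v T1 T2 Sg dv d1 IH1 d2 IH2|G Z op A B v T Sg p dv d IH].
  - exists B, p, (vd dv). split; [|reflexivity]. apply typing_sem. now apply wft_ZIn with (2 := p).
  - exists (vd dv). do 2 eexists.
    split; [apply typing_sem; constructor|split; [apply IH1|split; [apply IH2|reflexivity]]];
      assumption.
  - split; [now apply wfs_NoDup|].
    exists A, B, p, (vd dv). eexists.
    split; [apply typing_sem; now destruct (wfs_InSig wS p)|split; [apply IH|reflexivity]];
      assumption.
Qed.

(** * Templates *)

Definition fsub_sem (b : bool) (Z : tys) (D : cty) (G : list vty) (fz : nat -> val)
  (z : env G -> forall j : zidx Z, zar Z j -> cden D) : Prop :=
  forall j B (p : ZIn Z j B),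
    vsem b (fz j) G (TFun B D) (fun e x => z e (zin_idx p) (zin_in p x)).

Lemma fsub_sem_weaken {b A Z D G fz z} : fsub_sem b Z D G fz z ->
  fsub_sem b Z D (A :: G) (fun j => renv S (fz j)) (fun e => z (fst e)).
Proof. intros h j B p. exact (vsem_weaken (h j B p)). Qed.

(** Instantiation turns operation nodes into operation calls, and these denote the components of the
    free interpretation. *)
Lemma inst_sem {b A Sg E T} : forall {Gt Z F}, tsem b T Gt Z Sg (cden (CTy A Sg E)) F ->
  forall {G s t fz z}, sub_sem b Gt G s t -> fsub_sem b Z (CTy A Sg E) G fz z ->
  csem b (inst s fz Z T) G (CTy A Sg E) (fun e => F (@freeI Sg (vden A)) (t e) (z e)).
Proof.
  induction T as [j v|v T1 IH1 T2 IH2|op v T IH]; intros Gt Z F.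
  - intros (B & p & g & h & ->) G s t fz z hs hz.
    simpl inst. rewrite (ztyn_ZIn p).
    do 2 eexists. split; [exact (hz _ _ p)|split; [exact (vsem_sub h hs)|reflexivity]].
  - intros (g & F1 & F2 & h & h1 & h2 & ->) G s t fz z hs hz.
    do 3 eexists. split; [exact (vsem_sub h hs)|].
    split; [exact (IH1 _ _ _ h1 _ _ _ _ _ hs hz)|].
    split; [exact (IH2 _ _ _ h2 _ _ _ _ _ hs hz)|reflexivity].
  - intros (nd & Ao & Bo & p & g & k & h & h1 & ->) G s t fz z hs hz.
    split; [exact nd|]. exists Ao, Bo, p. do 2 eexists.
    split; [exact (vsem_sub h hs)|].
    split; [exact (IH _ _ _ h1 _ _ _ _ _ (sub_sem_up hs) (fsub_sem_weaken hz))|reflexivity].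
Qed.

(** A substitution lemma for the handler translation: each operation node becomes a clause body,
    which denotes the component of [H] there. The map [w] embeds the context of the clauses and is
    weakened at each binder of the template. *)
Lemma htrans_sem {b h Sg D G0 H T} :
  sigsem (fun op A B => hsem b h op A B G0 D) Sg H ->
  forall {Gt Z F}, tsem b T Gt Z Sg (cden D) F ->
  forall {G s t fz z w r}, sub_sem b Gt G s t -> fsub_sem b Z D G fz z -> sub_sem b G0 G w r ->
  csem b (htrans h Sg Z s fz w T) G D (fun e => F (H (r e)) (t e) (z e)).
Proof.
  intros hH.
  induction T as [j v|v T1 IH1 T2 IH2|op v T IH]; intros Gt Z F.
  - intros (B & p & g & hv & ->) G s t fz z w r hs hz hw.
    simpl htrans. rewrite (ztyn_ZIn p).
    do 2 eexists. split; [exact (hz _ _ p)|split; [exact (vsem_sub hv hs)|reflexivity]].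
  - intros (g & F1 & F2 & hv & h1 & h2 & ->) G s t fz z w r hs hz hw.
    do 3 eexists. split; [exact (vsem_sub hv hs)|].
    split; [exact (IH1 _ _ _ h1 _ _ _ _ _ _ _ hs hz hw)|].
    split; [exact (IH2 _ _ _ h2 _ _ _ _ _ _ _ hs hz hw)|reflexivity].
  - intros (nd & Ao & Bo & p & g & k & hv & h1 & ->) G s t fz z w r hs hz hw.
    simpl htrans. rewrite (slookupB_InSig p nd).
    pose proof (IH _ _ _ h1 _ _ _ _ _ _ _ (sub_sem_up hs) (fsub_sem_weaken hz)
      (sub_sem_weaken (A := Bo) hw)) as hk.
    pose proof (hsem_lookup _ (sigsem_InSig _ _ _ _ _ p _ hH)) as hc.
    (* The continuation variable of the clause receives the rest of the template, already
       interpreted by [H]. *)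
    refine (csem_sub hc (sub_sem_cons (A := TFun Bo D) (sub_sem_cons hw (vsem_sub hv hs))
      (f := fun e x => k (H (r e)) (t e, x) (z e)) _)).
    split; [reflexivity|]. eexists. split; [exact hk|reflexivity].
Qed.

(** * Environments of concatenated contexts and of the variables [f_j] *)

Fixpoint env_left {G1 G2} : env (G1 ++ G2) -> env G1 :=
  match G1 return env (G1 ++ G2) -> env G1 with
  | [] => fun _ => tt
  | A :: G1' => fun e => (env_left (fst e), snd e)
  end.

Fixpoint env_right {G1 G2} : env (G1 ++ G2) -> env G2 :=
  match G1 return env (G1 ++ G2) -> env G2 with
  | [] => fun e => e
  | A :: G1' => fun e => env_right (G1 := G1') (fst e)
  end.

Fixpoint env_app {G1 G2} : env G1 -> env G2 -> env (G1 ++ G2) :=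
  match G1 return env G1 -> env G2 -> env (G1 ++ G2) with
  | [] => fun _ e => e
  | A :: G1' => fun e1 e2 => (env_app (fst e1) e2, snd e1)
  end.

Lemma env_left_app {G1 G2} (e1 : env G1) (e2 : env G2) : env_left (env_app e1 e2) = e1.
Proof.
  induction G1 as [|A G1 IH]; simpl in *; [now destruct e1|].
  destruct e1 as [e1 a]. simpl. now rewrite IH.
Qed.

Lemma env_right_app {G1 G2} (e1 : env G1) (e2 : env G2) : env_right (env_app e1 e2) = e2.
Proof. induction G1 as [|A G1 IH]; simpl in *; auto. Qed.

Lemma erel_app {G1 G2} : forall (e1 e1' : env G1) (e2 e2' : env G2),
  erel G1 e1 e1' -> erel G2 e2 e2' -> erel (G1 ++ G2) (env_app e1 e2) (env_app e1' e2').
Proof.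
  induction G1 as [|A G1 IH]; simpl; [trivial|].
  intros e1 e1' e2 e2' [h1 h2] h. auto.
Qed.

Lemma VarIn_left {G1 G2 n A} (p : VarIn G1 n A) :
  exists q : VarIn (G1 ++ G2) n A, forall e, proj q e = proj p (env_left e).
Proof.
  induction p as [G A|G n A B p [q hq]]; simpl.
  - exists (vin_here _ _). reflexivity.
  - exists (vin_there _ q). intros e. apply hq.
Qed.

Lemma VarIn_right {G1 G2 n A} (p : VarIn G2 n A) :
  exists q : VarIn (G1 ++ G2) (length G1 + n) A, forall e, proj q e = proj p (env_right e).
Proof.
  induction G1 as [|B G1 [q hq]]; simpl.
  - exists p. reflexivity.
  - exists (vin_there _ q). intros e. apply hq.
Qed.

Fixpoint env_conts {Z D} : env (functx Z D) -> forall j : zidx Z, zar Z j -> cden D :=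
  match Z return env (functx Z D) -> forall j : zidx Z, zar Z j -> cden D with
  | YNil => fun _ j => match j with end
  | YCons B r => fun e j =>
      match j return zar (YCons B r) j -> cden D with
      | None => snd e
      | Some j' => env_conts (Z := r) (fst e) j'
      end
  end.

(** This allows arbitrary semantic continuations to be fed to an equality derived for the variables
    [f_j]. *)
Fixpoint conts_env {Z D} : (forall j : zidx Z, zar Z j -> cden D) -> env (functx Z D) :=
  match Z return (forall j : zidx Z, zar Z j -> cden D) -> env (functx Z D) with
  | YNil => fun _ => tt
  | YCons B r => fun z => (conts_env (Z := r) (fun j => z (Some j)), z None)
  end.

Lemma env_conts_env {Z D} (z : forall j : zidx Z, zar Z j -> cden D) :
  env_conts (conts_env z) = z.
Proof.
  apply functional_extensionality_dep. intros j.
  induction Z as [|B r IH]; simpl in *; destruct j; trivial.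
  apply (IH (fun j => z (Some j))).
Qed.

Lemma env_conts_rel {Z D} : forall e e', erel (functx Z D) e e' ->
  forall j x x', zrel Z j x x' -> crel D (env_conts e j x) (env_conts e' j x').
Proof.
  induction Z as [|B r IH]; simpl; intros e e' he j; destruct j.
  - apply (IH _ _ (proj1 he)).
  - apply (proj2 he).
Qed.

Lemma conts_env_rel {Z D} : forall z z' : forall j : zidx Z, zar Z j -> cden D,
  (forall j x x', zrel Z j x x' -> crel D (z j x) (z' j x')) ->
  erel (functx Z D) (conts_env z) (conts_env z').
Proof.
  induction Z as [|B r IH]; simpl; intros z z' hz; [trivial|]. split.
  - apply IH. intros j. apply (hz (Some j)).
  - apply (hz None).
Qed.

Lemma VarIn_functx {Z D j B} (p : ZIn Z j B) :
  exists q : VarIn (functx Z D) j (TFun B D),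
    forall e, proj q e = (fun x : vden B => env_conts e (zin_idx p) (zin_in p x)).
Proof.
  induction p as [B r|A r j B p [q hq]].
  - exists (vin_here (functx r D) (TFun B D)). reflexivity.
  - exists (vin_there (TFun A D) q). intros e. apply hq.
Qed.

Lemma sub_sem_conts {b Z D G s t} : sub_sem b (functx Z D) G s t ->
  fsub_sem b Z D G s (fun e => env_conts (t e)).
Proof.
  intros hs j B p. destruct (VarIn_functx (D := D) p) as [q hq].
  refine (eq_ind (fun e => proj q (t e)) (vsem b (s j) G (TFun B D)) (hs _ _ q) _ _).
  apply functional_extensionality. intros e. apply hq.
Qed.

Lemma vsem_var {b G n A} (q : VarIn G n A) f : (forall e, proj q e = f e) -> vsem b (VVar n) G A f.
Proof. intros h. exists q. symmetry. now apply functional_extensionality. Qed.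

Lemma htrans_top_sem {b h Sg D G H T} {xs zs F} :
  sigsem (fun op A B => hsem b h op A B G D) Sg H ->
  tsem b T (tys2l xs) zs Sg (cden D) F ->
  csem b (htrans_top h Sg xs zs T) (functx zs D ++ tys2l xs ++ G) D
    (fun e => F (H (env_right (env_right e))) (env_left (env_right e)) (env_conts (env_left e))).
Proof.
  intros hH hT.
  assert (hl : length (tys2l zs) = length (functx zs D)) by (symmetry; apply length_map).
  (* The indices of [htrans_top] count [zs], while the context contains its image under [map]. *)
  unfold htrans_top. rewrite hl.
  apply (htrans_sem hH hT (t := fun e => env_left (env_right e))
    (r := fun e => env_right (env_right e)) (z := fun e => env_conts (env_left e))).
  - intros n A p. destruct (VarIn_left (G2 := G) p) as [q hq].
    destruct (VarIn_right (G1 := functx zs D) q) as [q' hq'].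
    apply (vsem_var q'). intros e. now rewrite hq', hq.
  - apply sub_sem_conts. intros n A p.
    destruct (VarIn_left (G2 := tys2l xs ++ G) p) as [q hq].
    exact (vsem_var q _ hq).
  - intros n A p. destruct (VarIn_right (G1 := tys2l xs) p) as [q hq].
    destruct (VarIn_right (G1 := functx zs D) q) as [q' hq'].
    rewrite <- Nat.add_assoc. apply (vsem_var q'). intros e. now rewrite hq', hq.
Qed.

(** * Soundness of the equational logic *)

Lemma interp_rel_sym {Sg D} (H H' : interp Sg (cden D)) : interp_rel H H' -> interp_rel H' H.
Proof.
  intros h i a a' ra k k' rk. apply crel_sym, h.
  - now apply sarrel_per.
  - intros x x' rx. apply crel_sym, rk. now apply scorel_per.
Qed.

Lemma interp_rel_trans {Sg D} (H H' H'' : interp Sg (cden D)) :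
  interp_rel H H' -> interp_rel H' H'' -> interp_rel H H''.
Proof.
  intros h h' i a a' ra k k' rk. eapply crel_trans; [exact (h i a a' ra k k' rk)|].
  apply h'.
  - eapply sarrel_per; [apply sarrel_per|]; exact ra.
  - intros x x' rx. eapply crel_trans; [apply crel_sym, (rk x x)|exact (rk x x' rx)].
    eapply scorel_per; [|apply scorel_per]; exact rx.
Qed.

(** The quantifier over derivations matches that of [valid_interp]: a derivation met there may
    differ from the one stored in the well-formedness proof. *)
Definition good_thy (E : thy) (Sg : sig) : Prop :=
  forall (i : eidx E) (Y : Type),
    (forall d : tpt (tys2l (exs (eqn_at E i))) (ezs (eqn_at E i)) (eT1 (eqn_at E i)) Sg,
       tsem true (eT1 (eqn_at E i)) (tys2l (exs (eqn_at E i))) (ezs (eqn_at E i)) Sg Y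
         (fun H => tden d H)) /\
    (forall d : tpt (tys2l (exs (eqn_at E i))) (ezs (eqn_at E i)) (eT2 (eqn_at E i)) Sg,
       tsem true (eT2 (eqn_at E i)) (tys2l (exs (eqn_at E i))) (ezs (eqn_at E i)) Sg Y
         (fun H => tden d H)).

(** Since [lift_rel] wants one family over a partial equivalence, both handlers are joined into a
    family indexed by a Boolean and an environment; any two members over related environments are
    related. *)
Lemma handle_rel {G A Sg E D} {g g' : env (A :: G) -> cden D} {H H' : env G -> interp Sg (cden D)} :
  good_thy E Sg ->
  (forall e e', erel (A :: G) e e' -> crel D (g e) (g' e')) ->
  (forall e e', erel G e e' -> interp_rel (H e) (H' e')) ->
  valid_interp E H -> valid_interp E H' ->
  forall e e', erel G e e' ->
  vrel (THand (CTy A Sg E) D) (lift (H e) (fun a => g (e, a))) (lift (H' e') (fun a => g' (e', a))).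
Proof.
  intros gE rg rH vH vH' e e' re t t' rt.
  pose (K := fun s : bool => if s then H else H').
  pose (l := fun (s : bool) (e : env G) (a : vden A) => if s then g (e, a) else g' (e, a)).
  assert (rl : forall s s' e e', erel G e e' ->
    vrel (TFun A D) (l s e : vden (TFun A D)) (l s' e')).
  { assert (b : forall e e', erel G e e' -> vrel (TFun A D) (l true e : vden (TFun A D)) (l false e')).
    { intros x x' rx a a' ra. now apply rg. }
    destruct (vrel_per (TFun A D)) as [sy tr].
    intros [] [] x x' rx.
    (* Relatedness of one side to itself is obtained by going to the other side and back. *)
    - apply tr with (l false x'); [auto|]. apply sy, b. now apply erel_refl_r with x.
    - auto.
    - apply sy, b. now apply erel_sym.
    - apply tr with (l true x); [|auto]. apply sy, b. now apply erel_refl_l with x'. }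
  assert (rK : forall s s' e e', erel G e e' -> interp_rel (K s e) (K s' e')).
  { intros [] [] x x' rx; simpl.
    - apply interp_rel_trans with (H' x'); [auto|].
      apply interp_rel_sym, rH. now apply erel_refl_r with x.
    - auto.
    - apply interp_rel_sym, rH. now apply erel_sym.
    - apply interp_rel_trans with (H x); [|auto].
      apply interp_rel_sym, rH. now apply erel_refl_l with x'. }
  assert (vK : forall s, valid_interp E (K s)) by (intros []; assumption).
  refine (@lift_rel A Sg E D (bool * env G) (fun w w' => erel G (snd w) (snd w')) _ _
    (fun w => K (fst w) (snd w)) (fun w => l (fst w) (snd w)) _ _ _ t t' rt
    (true, e) (false, e') re).
  - intros w w'. apply erel_sym.
  - intros w1 w2 w3. apply erel_trans.
  - intros w w' rw. apply (rl (fst w) (fst w') _ _ rw).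
  - intros w w' rw. apply (rK _ _ _ _ rw).
  - intros w w' rw i d1 d2 a a' ra z z' rz.
    eapply crel_trans; [exact (vK (fst w) _ _ rw i d1 d2 a a' ra z z' rz)|].
    apply (tsem_rel (proj2 (gE i (cden D)) d2)).
    + apply rK. now apply erel_refl_r with (snd w).
    + now apply erel_refl_r with a.
    (* That [z'] respects the relation by itself follows by passing through [z j x]. *)
    + intros j x x' rx. eapply crel_trans; [apply crel_sym, (rz j x x)|exact (rz j x x' rx)].
      eapply zrel_per; [|apply zrel_per]; exact rx.
Qed.

(** Membership of both sides is a premise because congruence for handlers could not deliver it.
    Transitivity and substitution recover it for the terms they introduce from their typing
    premises. *)
Definition veq_sound (G : list vty) (v v' : val) (A : vty) : Prop :=
  forall f f', vsem true v G A f -> vsem true v' G A f' ->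
  forall e e', erel G e e' -> vrel A (f e) (f' e').

Definition ceq_sound (G : list vty) (c c' : comp) (C : cty) : Prop :=
  forall f f', csem true c G C f -> csem true c' G C f' ->
  forall e e', erel G e e' -> crel C (f e) (f' e').

Lemma veq_sound_same {G v v' A F} :
  vsem true v G A F -> vsem true v' G A F -> veq_sound G v v' A.
Proof.
  intros h h' f f' hf hf' e e' re.
  rewrite (vsem_det hf h), (vsem_det hf' h'). now apply (vsem_rel h).
Qed.

(** Serves the beta and eta rules: their two sides have the same denotation, and flag [true] makes
    it related to itself. *)
Lemma ceq_sound_same {G c c' C F} :
  csem true c G C F -> csem true c' G C F -> ceq_sound G c c' C.
Proof.
  intros h h' f f' hf hf' e e' re.
  rewrite (csem_det hf h), (csem_det hf' h'). now apply (csem_rel h).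
Qed.

Lemma wft_VarIn {Z n A} : wft Z -> VarIn (tys2l Z) n A -> wfv A.
Proof.
  intros w. revert n. induction w; simpl; intros n p; inversion p; subst; eauto.
Qed.

Lemma wft_functx {Z C n A} : wft Z -> wfc C -> VarIn (functx Z C) n A -> wfv A.
Proof.
  intros w wC. revert n. induction w; simpl; intros n p; inversion p; subst; eauto.
  now constructor.
Qed.

Lemma lift_freeI_Ret {Sg X} (t : FreeS Sg X) : lift (@freeI Sg X) Ret t = t.
Proof.
  induction t as [x|i a k IH]; simpl; [reflexivity|].
  unfold freeI at 1. f_equal. now apply functional_extensionality.
Qed.

Lemma sub_sem_forget {G G' s t} : sub_sem true G G' s t -> sub_sem false G G' s t.
Proof. intros h n A p. apply sem_forget, h. Qed.

(** The template derivations come from the well-formedness hypothesis, outside the induction, so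
    they are used at flag [false]. Functionality across flags then exhibits both sides as templates
    under the free interpretation. *)
Lemma axiom_sound {G A Sg E} (i : eidx E) {s t fz r} :
  wfc (CTy A Sg E) ->
  sub_sem true (tys2l (exs (eqn_at E i))) G s t ->
  sub_sem true (functx (ezs (eqn_at E i)) (CTy A Sg E)) G fz r ->
  ceq_sound G (inst s fz (ezs (eqn_at E i)) (eT1 (eqn_at E i)))
              (inst s fz (ezs (eqn_at E i)) (eT2 (eqn_at E i))) (CTy A Sg E).
Proof.
  intros w hs hf f f' h h' e e' re.
  destruct (wfc_inv w) as [[wA wS] wE].
  destruct (wfe_at wE i) as [[[wx wz] d1] d2].
  pose proof (sub_sem_conts (sub_sem_forget hf)) as hz.
  rewrite (csem_det h (inst_sem (tpt_tsem d1 _ wz wS) (sub_sem_forget hs) hz)).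
  rewrite (csem_det h' (inst_sem (tpt_tsem d2 _ wz wS) (sub_sem_forget hs) hz)).
  apply CR_eq.
  - apply exrel_erel. now apply (sub_sem_rel hs).
  - intros j x x' rx.
    apply (env_conts_rel _ _ (sub_sem_rel hf _ _ re)). now apply ezrel_zrel.
Qed.

(** Evaluating the derived equality at the concatenation of [conts_env z], [a] and [e] turns the
    translated templates into the original ones interpreted by [H]. *)
Lemma valid_interp_cons {G h xs zs T1 T2 E Sg D H} :
  good_thy (ECons (Eqn xs zs T1 T2) E) Sg ->
  sigsem (fun op A B => hsem true h op A B G D) Sg H ->
  valid_interp E H ->
  ceq_sound (functx zs D ++ tys2l xs ++ G)
    (htrans_top h Sg xs zs T1) (htrans_top h Sg xs zs T2) D ->
  valid_interp (ECons (Eqn xs zs T1 T2) E) H.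
Proof.
  intros gE hH vH hQ e e' re [i|]; [exact (vH e e' re i)|]. simpl.
  intros d1 d2 a a' ra z z' rz.
  destruct (gE None (cden D)) as [g1 g2].
  pose proof (hQ _ _ (htrans_top_sem hH (g1 d1)) (htrans_top_sem hH (g2 d2))
    (env_app (conts_env z) (env_app a e)) (env_app (conts_env z') (env_app a' e'))
    (erel_app _ _ _ _ (conts_env_rel _ _ rz) (erel_app _ _ _ _ ra re))) as r.
  cbv beta in r. rewrite !env_right_app, !env_left_app, !env_conts_env in r.
  exact r.
Qed.

(* The joint induction over typing and equality *)
Scheme vt_sind := Induction for vt Sort Prop
  with ct_sind := Induction for ct Sort Prop
  with ht_sind := Induction for ht Sort Prop
  with hcl_sind := Induction for hcl Sort Prop
  with hm_sind := Induction for hm Sort Prop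
  with hceqa_sind := Induction for hceqa Sort Prop
  with hceq_sind := Induction for hceq Sort Prop
  with vts_sind := Induction for vts Sort Prop
  with tpt_sind := Induction for tpt Sort Prop
  with wfc_sind := Induction for wfc Sort Prop
  with wfe_sind := Induction for wfe Sort Prop
  with veq_sind := Induction for veq Sort Prop
  with ceq_sind := Induction for ceq Sort Prop.
Combined Scheme judgement_ind from vt_sind, ct_sind, ht_sind, hcl_sind, hm_sind,
  hceqa_sind, hceq_sind, vts_sind, tpt_sind, wfc_sind, wfe_sind, veq_sind, ceq_sind.

(** Clause congruence is stated for arbitrary [P] and [P'] because [hceqa] descends through permuted
    copies of the clause lists, while the semantics is known for the original lists. The [hceq] case
    takes [hsem] of the originals. *)
Lemma judgement_sound :
  (forall G v A (d : vt G v A), wfv A -> vsem true v G A (vd d)) /\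
  (forall G c C (d : ct G c C), wfc C -> csem true c G C (cd d)) /\
  (forall G h Sg D (d : ht G h Sg D), wfs Sg -> wfc D ->
     sigsem (clauses_in true h G D) Sg (htd d)) /\
  (forall G h Sg D (d : hcl G h Sg D), wfs Sg -> wfc D ->
     sigsem (fun op A B => hsem true h op A B G D) Sg (hcld d)) /\
  (forall G h E Sg D (d : hm G h E Sg D), wfs Sg -> wfc D -> good_thy E Sg ->
     sigsem (fun op A B => hsem true h op A B G D) Sg (hmd d) /\
     valid_interp E (hmd d)) /\
  (forall G h h' Sg D (d : hceqa G h h' Sg D), wfc D ->
     forall P P' : clause_pred G D,
     (forall op A B f c, P op A B f -> In (op, c) (hl h) ->
        csem true c (TFun B D :: A :: G) D f) ->
     (forall op A B f c, P' op A B f -> In (op, c) (hl h') ->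
        csem true c (TFun B D :: A :: G) D f) ->
     forall H H', sigsem P Sg H -> sigsem P' Sg H' ->
     forall e e', erel G e e' -> interp_rel (H e) (H' e')) /\
  (forall G h h' Sg D (d : hceq G h h' Sg D), wfs Sg -> wfc D ->
     forall H H', sigsem (fun op A B => hsem true h op A B G D) Sg H ->
     sigsem (fun op A B => hsem true h' op A B G D) Sg H' ->
     forall e e', erel G e e' -> interp_rel (H e) (H' e')) /\
  (forall G vs As (d : vts G vs As), (forall n A, VarIn As n A -> wfv A) ->
     exists t, sub_sem true As G (fun n => nth n vs VUnit) t) /\
  (forall G Z T Sg (d : tpt G Z T Sg), wft Z -> wfs Sg ->
     forall Y, tsem true T G Z Sg Y (fun H => tden d H)) /\
  (forall C (d : wfc C), match C with CTy A Sg E => good_thy E Sg end) /\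
  (forall E Sg (d : wfe E Sg), wfs Sg -> good_thy E Sg) /\
  (forall G v v' A (d : veq G v v' A), wfv A -> veq_sound G v v' A) /\
  (forall G c c' C (d : ceq G c c' C), wfc C -> ceq_sound G c c' C).
Proof.
  apply judgement_ind.
  - intros G n A p _. exists p. reflexivity.
  - reflexivity.
  - reflexivity.
  - reflexivity.
  - intros G A C c wA d IH w. inversion_clear w. split; [trivial|].
    exists (cd d). auto.
  - intros G A Sg E D cr h w gE d IH dh IHh wAD. inversion_clear wAD.
    destruct (wfc_inv w) as [[wA wS] wE]. destruct IHh as [h1 h2]; auto.
    split; [trivial|split; [now apply wfs_NoDup|]].
    exists (cd d), (hmd dh). repeat split; auto.
  - intros G v c1 c2 C dv IHv d1 IH1 d2 IH2 w.
    exists (vd dv), (cd d1), (cd d2). repeat split; auto. apply IHv. constructor.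
  - intros G A C v1 v2 wA d1 IH1 d2 IH2 w.
    exists (vd d1), (vd d2). split; [|split]; auto. apply IH1. now constructor.
  - intros G v A Sg E dv IHv w. destruct (wfc_inv w) as [[wA wS] wE].
    exists (vd dv). auto.
  - intros G op Ao Bo v c A Sg E p dv IHv d IH w.
    destruct (wfc_inv w) as [[wA wS] wE].
    split; [now apply wfs_NoDup|].
    exists Ao, Bo, p, (vd dv), (cd d). split; [|split]; auto.
    apply IHv. now destruct (wfs_InSig wS p).
  - intros G A B Sg E c1 c2 wA d1 IH1 d2 IH2 w.
    destruct (wfc_inv w) as [[wB wS] wE].
    exists (cd d1), (cd d2). split; [|split]; auto. apply IH1. now constructor.
  - intros G C D v c wC _ dv IHv d IH w.
    exists (vd dv), (cd d). split; [|split]; auto. apply IHv. now constructor.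
  - intros G D _ _. exact I.
  - intros G op A B Sg D c h d IH dh IHh wS wD. inversion_clear wS.
    apply clauses_in_cons; auto.
  - intros G h h' Sg D pm dh IHh wS wD.
    apply (clauses_in_hsem pm); [|auto].
    rewrite (ht_names dh). now apply wfs_NoDup.
  - intros G h Sg D dh IHh wS wD _. split; [now apply IHh|].
    intros e e' _ [].
  - intros G h xs zs T1 T2 E Sg D dh IHh q IHq wS wD gE.
    destruct IHh as [h1 h2]; trivial; [intros i; exact (gE (Some i))|].
    split; [exact h1|]. exact (valid_interp_cons gE h1 h2 (IHq wD)).
  - intros G D _ P P' _ _ H H' _ _ e e' _ [].
  - intros G op A B Sg D c c' h h' q IHq dh IHh wD P P' hP hP' H H' [h1 h2] [h1' h2'] e e' re.
    intros i; destruct i as [i|].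
    + refine (IHh wD P P' _ _ _ _ h2 h2' e e' re i).
      * intros o A1 B1 f c1 hf hin. apply (hP _ _ _ _ _ hf). now right.
      * intros o A1 B1 f c1 hf hin. apply (hP' _ _ _ _ _ hf). now right.
    + intros a a' ra k k' rk.
      exact (IHq wD _ _ (hP _ _ _ _ c h1 (or_introl eq_refl))
        (hP' _ _ _ _ c' h1' (or_introl eq_refl))
        (e, a, k) (e', a', k') (conj (conj re ra) rk)).
  - intros G h h' h1 h1' Sg D pm pm' dh IHh wS wD H H' hH hH'.
    destruct (hceqa_names dh) as [n1 n2]. pose proof (wfs_NoDup wS) as nd.
    refine (IHh wD _ _ _ _ H H' hH hH').
    + intros op A B f c hf hin. refine (hsem_elim h _ _ hf).
      * apply (Permutation_NoDup_fst _ _ pm). now rewrite n1.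
      * now apply Permutation_in with (1 := Permutation_sym pm).
    + intros op A B f c hf hin. refine (hsem_elim h' _ _ hf).
      * apply (Permutation_NoDup_fst _ _ pm'). now rewrite n2.
      * now apply Permutation_in with (1 := Permutation_sym pm').
  - intros G _. exists (fun _ => tt). intros n A p. inversion p.
  - intros G v vs A As d IH ds IHs w.
    destruct IHs as [t ht]; [intros n B p; exact (w _ _ (vin_there A p))|].
    exists (fun e => (t e, vd d e)). intros n B p. dependent destruction p.
    + exact (IH (w _ _ (vin_here _ _))).
    + exact (ht _ _ p).
  - intros G Z j B v Sg p dv IHv wZ wS Y. exists B, p, (vd dv).
    split; [apply IHv; now apply wft_ZIn with (2 := p)|reflexivity].
  - intros G Z v T1 T2 Sg dv IHv d1 IH1 d2 IH2 wZ wS Y.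
    exists (vd dv). do 2 eexists.
    split; [apply IHv; constructor|split; [apply IH1|split; [apply IH2|reflexivity]]];
      assumption.
  - intros G Z op A B v T Sg p dv IHv d IH wZ wS Y.
    split; [now apply wfs_NoDup|].
    exists A, B, p, (vd dv). eexists.
    split; [apply IHv; now destruct (wfs_InSig wS p)|split; [apply IH|reflexivity]];
      assumption.
  - intros A Sg E wA wS wE IH. auto.
  - intros Sg _ [].
  - intros xs zs T1 T2 E Sg wx wz d1 IH1 d2 IH2 wE IHE wS [i|] Y; [exact (IHE wS i Y)|].
    simpl. split; intros d.
    (* The arbitrary derivation [d] is identified with the stored [d1], to which the induction
       hypothesis applies. *)
    + rewrite (tsem_det (tpt_tsem d Y wz wS) (IH1 wz wS Y)). apply IH1; assumption.
    + rewrite (tsem_det (tpt_tsem d Y wz wS) (IH2 wz wS Y)). apply IH2; assumption.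
  - intros G v A d IH w. exact (veq_sound_same (IH w) (IH w)).
  - intros G v v' A d IH w f f' hf hf' e e' re. apply vrel_per.
    apply (IH w); trivial. now apply erel_sym.
  - intros G v1 v2 v3 A q IH1 d IH q' IH2 w f f' hf hf' e e' re.
    eapply vrel_per; [exact (IH1 w _ _ hf (IH w) e e' re)|].
    apply (IH2 w); auto. now apply erel_refl_r with e.
  - intros G B A v1 v2 w1 w2 wB d1 IH1 d2 IH2 dw1 IHw1 dw2 IHw2 q IHq q' IHq' w
      f f' hf hf' e e' re.
    rewrite (vsem_det hf (vsem_sub (IH1 w) (sub_sem_sub1 (IHw1 wB)))).
    rewrite (vsem_det hf' (vsem_sub (IH2 w) (sub_sem_sub1 (IHw2 wB)))).
    apply (IHq w); auto. split; [exact re|].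
    apply (IHq' wB); auto.
  - intros G A C c c' wA q IH w f f' (_ & g & hg & ->) (_ & g' & hg' & ->) e e' re a a' ra.
    inversion_clear w. apply IH; trivial. split; assumption.
  - intros G A Sg E D cr cr' h h' wC gE q IHq qh IHh w f f'
      (_ & _ & g & H & hg & hH & hv & ->) (_ & _ & g' & H' & hg' & hH' & hv' & ->) e e' re.
    inversion_clear w. destruct (wfc_inv wC) as [[wA wS] wE].
    (* Validity of the two handlers is [hv] and [hv'], taken from membership at flag [true]. *)
    apply handle_rel; auto. apply IHq; auto.
  - intros G v d IH w f f' hf hf' e e' re. simpl. now destruct (f e), (f' e').
  - intros G v A C d IH w. refine (veq_sound_same (F := vd d) _ (IH w)).
    split; [trivial|]. exists (fun e => vd d (fst e) (snd e)). split; [|reflexivity].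
    do 2 eexists. split; [exact (vsem_weaken (IH w))|].
    split; [exists (vin_here G A); reflexivity|reflexivity].
  - intros G c C d IH w. exact (ceq_sound_same (IH w) (IH w)).
  - intros G c c' C d IH w f f' hf hf' e e' re. apply crel_sym.
    apply (IH w); trivial. now apply erel_sym.
  - intros G c1 c2 c3 C q IH1 d IH q' IH2 w f f' hf hf' e e' re.
    eapply crel_trans; [exact (IH1 w _ _ hf (IH w) e e' re)|].
    apply (IH2 w); auto. now apply erel_refl_r with e.
  - intros G B C c1 c2 w1 w2 wB d1 IH1 d2 IH2 dw1 IHw1 dw2 IHw2 q IHq q' IHq' w
      f f' hf hf' e e' re.
    rewrite (csem_det hf (csem_sub (IH1 w) (sub_sem_sub1 (IHw1 wB)))).
    rewrite (csem_det hf' (csem_sub (IH2 w) (sub_sem_sub1 (IHw2 wB)))).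
    apply (IHq w); auto. split; [exact re|].
    apply (IHq' wB); auto.
  - intros G v v' c1 c1' c2 c2' C q IHq q1 IH1 q2 IH2 w
      f f' (g & f1 & f2 & a1 & a2 & a3 & ->) (g' & f1' & f2' & b1 & b2 & b3 & ->) e e' re.
    pose proof (IHq wf_bool _ _ a1 b1 e e' re) as hb. simpl in hb. rewrite hb.
    destruct (g' e'); [apply IH1|apply IH2]; assumption.
  - intros G A C v1 v1' v2 v2' wA q1 IH1 q2 IH2 w
      f f' (f1 & f2 & a1 & a2 & ->) (f1' & f2' & b1 & b2 & ->) e e' re.
    apply (IH1 (wf_fun wA w) _ _ a1 b1 e e' re). now apply IH2.
  - intros G v v' A Sg E q IH w f f' (g & a & ->) (g' & b & ->) e e' re.
    destruct (wfc_inv w) as [[wA wS] wE]. apply CR_ret. now apply IH.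
  - intros G op Ao Bo v v' c c' A Sg E p q IHq q' IHq' w f f'
      (nd & Ao1 & Bo1 & p1 & g & k & a1 & a2 & ->) (_ & Ao2 & Bo2 & p2 & g' & k' & b1 & b2 & ->)
      e e' re.
    (* Distinct names identify the position of [op] used by the rule with those used by the two
       denotations. *)
    unify_InSig nd p p1. unify_InSig nd p1 p2.
    destruct (wfc_inv w) as [[wA wS] wE]. destruct (wfs_InSig wS p2) as [wAo wBo].
    apply CR_op.
    + apply sarrel_insig. now apply IHq.
    + intros x x' rx. apply IHq'; trivial. split; [exact re|]. now apply scorel_insig.
  - intros G A B Sg E c1 c1' c2 c2' wA q1 IH1 q2 IH2 w
      f f' (f1 & f2 & a1 & a2 & ->) (f1' & f2' & b1 & b2 & ->) e e' re.
    destruct (wfc_inv w) as [[wB wS] wE].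
    apply bind_rel.
    + intros a a' ra. apply IH2; trivial. split; assumption.
    + apply IH1; trivial. now constructor.
  - intros G C D v v' c c' wC _ q1 IH1 q2 IH2 w
      f f' (f1 & f2 & a1 & a2 & ->) (f1' & f2' & b1 & b2 & ->) e e' re.
    apply (IH1 (wf_hand wC w) _ _ a1 b1 e e' re). now apply IH2.
  - intros G c1 c2 C d1 IH1 d2 IH2 w. refine (ceq_sound_same (F := cd d1) _ (IH1 w)).
    exists (fun _ => true), (cd d1), (cd d2). repeat split; auto.
  - intros G c1 c2 C d1 IH1 d2 IH2 w. refine (ceq_sound_same (F := cd d2) _ (IH2 w)).
    exists (fun _ => false), (cd d1), (cd d2). repeat split; auto.
  - intros G A C c v wA d IH dv IHv w.
    refine (ceq_sound_same _ (csem_sub (IH w) (sub_sem_sub1 (IHv wA)))).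
    exists (fun e a => cd d (e, a)), (vd dv). split; [|split; [auto|reflexivity]].
    split; [trivial|]. exists (cd d). auto.
  - intros G A B Sg E v c wA dv IHv d IH w.
    refine (ceq_sound_same _ (csem_sub (IH w) (sub_sem_sub1 (IHv wA)))).
    exists (fun e => Ret (vd dv e)), (cd d). split; [|split; [auto|reflexivity]].
    exists (vd dv). auto.
  - intros G A B Sg E op Ao Bo v c1 c2 wA p dv IHv d1 IH1 d2 IH2 w.
    destruct (wfc_inv w) as [[wB wS] wE]. destruct (wfs_InSig wS p) as [wAo wBo].
    pose proof (wf_cty wA wS wE) as wAC. pose proof (wfs_NoDup wS) as nd.
    refine (ceq_sound_same (C := CTy B Sg E) (F := fun e => Opn (insig_idx p) (insig_ar p (vd dv e))
      (fun x => lift (@freeI Sg (vden B)) (fun a => cd d2 (e, a)) (cd d1 (e, insig_co p x)))) _ _).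
    + exists (fun e => Opn (insig_idx p) (insig_ar p (vd dv e)) (fun x => cd d1 (e, insig_co p x))),
        (cd d2).
      split; [|split; [auto|reflexivity]].
      split; [exact nd|]. exists Ao, Bo, p, (vd dv), (cd d1). auto.
    + split; [exact nd|]. exists Ao, Bo, p, (vd dv). eexists.
      split; [auto|split; [|]].
      * exists (cd d1). eexists. split; [auto|split; [|reflexivity]].
        exact (proj1 (proj2 (sem_ren true)) _ _ _ _ (IH2 w) _ _ _
          (ren_sem_up (ren_sem_S Bo G))).
      * reflexivity.
  - intros G A Sg E D cr h v d IH dv IHv w.
    assert (wC : wfc (CTy A Sg E)) by now inversion d.
    destruct (wfc_inv wC) as [[wA wS] wE].
    pose proof (IH (wf_hand wC w)) as hh.
    pose proof hh as (_ & nd & g & H & hg & hH & hv & hd).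
    refine (ceq_sound_same _ (csem_sub hg (sub_sem_sub1 (IHv wA)))).
    do 2 eexists. split; [exact hh|].
    split; [exists (vd dv); split; [auto|reflexivity]|].
    rewrite hd. reflexivity.
  - intros G A Sg E D cr h op Ao Bo v c d IH p dv IHv dc IHc w.
    assert (wC : wfc (CTy A Sg E)) by now inversion d.
    destruct (wfc_inv wC) as [[wA wS] wE]. destruct (wfs_InSig wS p) as [wAo wBo].
    pose proof (IH (wf_hand wC w)) as hh.
    pose proof hh as (_ & nd & g & H & hg & hH & hv & hd).
    (* With the handler written as an explicit lift, handling the operation computes to [H] at that
       operation. *)
    rewrite hd in hh.
    pose proof (hsem_lookup _ (sigsem_InSig _ _ _ _ _ p _ hH)) as hc.
    refine (ceq_sound_same _ (csem_sub hc (sub_sem_cons (A := TFun Bo D)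
      (sub_sem_cons (sub_sem_id true G) (IHv wAo))
      (f := fun e x => lift (H e) (fun a => g (e, a)) (cd dc (e, x))) _))).
    + eexists. exists (fun e => Opn (insig_idx p) (insig_ar p (vd dv e))
        (fun x => cd dc (e, insig_co p x))).
      split; [exact hh|split; [|reflexivity]].
      split; [exact nd|]. exists Ao, Bo, p, (vd dv), (cd dc). auto.
    + split; [trivial|].
      exists (fun e => lift (H (fst e)) (fun a => g (fst e, a)) (cd dc e)).
      split; [|reflexivity].
      do 2 eexists. split; [exact (vsem_weaken hh)|split; [auto|reflexivity]].
  - intros G v c C dv IHv d IH w.
    refine (ceq_sound_same _ (csem_sub (IH w) (sub_sem_sub1 (IHv wf_bool)))).
    exists (vd dv), (fun e => cd d (e, true)), (fun e => cd d (e, false)).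
    split; [exact (IHv wf_bool)|].
    split; [|split].
    + refine (csem_sub (IH w) (sub_sem_sub1 (A := TBool) (f := fun _ => true) _)). reflexivity.
    + refine (csem_sub (IH w) (sub_sem_sub1 (A := TBool) (f := fun _ => false) _)). reflexivity.
    + apply functional_extensionality. intros e. now destruct (vd dv e).
  - intros G c A Sg E d IH w. refine (ceq_sound_same _ (IH w)).
    exists (cd d), (fun e => Ret (snd e)). split; [auto|split].
    + exists snd. split; [exists (vin_here G A); reflexivity|reflexivity].
    + apply functional_extensionality. intros e. symmetry. apply lift_freeI_Ret.
  - intros G A Sg E i vs fs dv IHv df IHf w.
    destruct (wfc_inv w) as [[wA wS] wE].
    destruct (wfe_at wE i) as [[[wx wz] d1] d2].
    destruct IHv as [t ht]; [intros n B p; exact (wft_VarIn wx p)|].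
    destruct IHf as [r hr]; [intros n B p; exact (wft_functx wz w p)|].
    exact (axiom_sound i w ht hr).
Qed.

Theorem theorem15 :
  (* (1) soundness of L_eq: if G |- h |=_{E,Sg} D then every equation of E
     is validated by [[h]] up to the logical relation *)
  (forall (G : list vty) (h : hcls) (E : thy) (Sg : sig) (D : cty)
          (H : hm G h E Sg D),
      wfctx G -> wfs Sg -> wfe E Sg -> wfc D ->
      forall (e e' : env G), erel G e e' ->
      forall (i : eidx E)
        (d1 : tpt (tys2l (exs (eqn_at E i))) (ezs (eqn_at E i)) (eT1 (eqn_at E i)) Sg)
        (d2 : tpt (tys2l (exs (eqn_at E i))) (ezs (eqn_at E i)) (eT2 (eqn_at E i)) Sg)
        (a a' : env (tys2l (exs (eqn_at E i)))),
        erel (tys2l (exs (eqn_at E i))) a a' ->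
        forall (f f' : forall j : zidx (ezs (eqn_at E i)), zar (ezs (eqn_at E i)) j -> cden D),
          (forall j b b', zrel (ezs (eqn_at E i)) j b b' -> crel D (f j b) (f' j b')) ->
          crel D (tden d1 (hmd H e) a f) (tden d2 (hmd H e') a' f'))
  /\
  (* (2) derivable value equations are sound for ~ *)
  (forall (G : list vty) (v v' : val) (A : vty),
      veq G v v' A -> wfctx G -> wfv A ->
      forall (dv : vt G v A) (dv' : vt G v' A) (e e' : env G),
        erel G e e' -> vrel A (vd dv e) (vd dv' e'))
  /\
  (* (3) derivable computation equations are sound for ~ *)
  (forall (G : list vty) (c c' : comp) (C : cty),
      ceq G c c' C -> wfctx G -> wfc C ->
      forall (dc : ct G c C) (dc' : ct G c' C) (e e' : env G),
        erel G e e' -> crel C (cd dc e) (cd dc' e')).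
Proof.
  destruct judgement_sound
    as (hvt & hct & _ & _ & hhm & _ & _ & _ & _ & _ & hwfe & hveq & hceq).
  split; [|split].
  - intros G h E Sg D H _ wS wE wD. exact (proj2 (hhm _ _ _ _ _ H wS wD (hwfe _ _ wE wS))).
  - intros G v v' A q _ wA d d'. exact (hveq _ _ _ _ q wA _ _ (hvt _ _ _ d wA) (hvt _ _ _ d' wA)).
  - intros G c c' C q _ wC d d'. exact (hceq _ _ _ _ q wC _ _ (hct _ _ _ d wC) (hct _ _ _ d' wC)).
Qed.
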